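(* Let $(k_n)_{n\ge1}$ be a sequence of positive integers such that $k_n\le n$ for all $n$. Then, as $n\to\infty$, $$\mathbb{E}\big[\mathcal{L}_{<}(S_{k_n;n})\big]=2\sqrt{nk_n}-k_n+o(\sqrt{nk_n}).$$
   Context: A $k$-multiset permutation of size $n$ is a word $s=(s(1),\dots,s(kn))$ with letters in $\{1,\dots,n\}$ in which each letter appears exactly $k$ times; it is identified with the point set $\{(i,s(i)):1\le i\le kn\}\subset[0,\infty)^2$. $S_{k;n}$ denotes a $k$-multiset permutation of size $n$ chosen uniformly at random among all $\frac{(kn)!}{(k!)^n}$ of them. On $[0,\infty)^2$ define the partial orders $(x,y)\prec(x',y')$ iff $x<x'$ and $y<y'$, and $(x,y)\preccurlyeq(x',y')$ iff $x<x'$ and $y\le y'$. For a finite set $\mathcal P\subset[0,\infty)^2$, $\mathcal L_<(\mathcal P)$ is the largest $L$ such that there exist $P_1\prec P_2\prec\dots\prec P_L$ in $\mathcal P$, and $\mathcal L_\le(\mathcal P)$ is the largest $L$ such that there exist $P_1\preccurlyeq\dots\preccurlyeq P_L$ in $\mathcal P$. (Thus $\mathcal L_<(S_{k;n})$ is the length of a longest strictly increasing subsequence and $\mathcal L_\le(S_{k;n})$ of a longest non-decreasing subsequence.) *)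

(* Defs.v *)
From mathcomp Require Import all_boot all_order all_algebra.
From mathcomp Require Import reals.
Set Implicit Arguments. Unset Strict Implicit. Unset Printing Implicit Defensive.
Import Order.TTheory GRing.Theory Num.Theory.

(* A word of length m over the alphabet 'I_n = {0,..,n-1} (the letters
   {1,..,n} shifted by one, an order isomorphism); positions are 'I_m
   (positions {1,..,m} shifted by one). *)
Definition word (m n : nat) := {ffun 'I_m -> 'I_n}.

Definition is_kperm (k n : nat) (s : word (k * n) n) : bool :=
  [forall a : 'I_n, #|[set i | s i == a]| == k].

Definition strict_chain (m n : nat) (s : word m n) (A : {set 'I_m}) : bool :=
  [forall i in A, forall j in A, (i < j)%N ==> (s i < s j)%N].

Definition Llt (m n : nat) (s : word m n) : nat :=
  \max_(A : {set 'I_m} | strict_chain s A) #|A|.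

Definition ELlt (R : realType) (k n : nat) : R :=
  ((\sum_(s : word (k * n) n | is_kperm s) (Llt s)%:R)
     / (#|[set s : word (k * n) n | is_kperm s]|)%:R)%R.

(* Main.v *)
Require Import Defs.
From mathcomp Require Import all_boot all_order all_fingroup all_algebra.
From mathcomp Require Import reals.
From mathcomp Require Import zify ring lra.
Import Order.TTheory GRing.Theory Num.Theory.
Set Implicit Arguments. Unset Strict Implicit. Unset Printing Implicit Defensive.

(* Words are read with letter 0 as a blank, letter 1 as a "source" and a letter a >= 2
   as a point of row a.
   Processing row a in Hammersley's process with sources and sinks just shifts the
   subword on the letters {1, a} by one position: cyclically on a uniform word, or by
   inserting an independent letter (a possible sink) in front of an i.i.d. word. Both
   laws are preserved.

   Upper bound: turn the m smallest items into sources and rotate cyclically. Each of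
   the n rows adds at most k / (k + m) to the mean, so the mean is at most
   m + n k / (k + m); take m close to sqrt (n k) - k.

   Lower bound: merge consecutive rows so that each has many points, and compare with
   i.i.d. words of N rows with c points on average. With sources of total mass t - c and
   sinks of density c / t the stationary length has mean g t = t - c + N c / t, with
   minimum 2 s - c at t = s = sqrt (N c), and it is the maximum of a length using
   sources only and a length using sinks only. For t slightly above s the latter has mean
   at most 2 s - c < g t; both have variance at most their mean, so the former has mean
   close to g t. The mean length with sources is convex in their density and its slope
   near t = s is small, so removing the sources costs little. *)

(** * Chains with sources and sinks *)

(** Longest strictly increasing subsequence with all letters above [a]; for [a >= 1], blanks and
    sources are invisible to it. *)
Fixpoint ell (a : nat) (w : seq nat) : nat :=
  if w is x :: w' then
    if a < x then maxn (ell a w') (ell x w').+1 else ell a w'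
  else 0.

(* Sources may be repeated, and are left for good at the first row letter used. *)
Fixpoint slen (a : nat) (w : seq nat) : nat :=
  if w is x :: w' then
    if x == 1 then (slen a w').+1
    else if a < x then maxn (slen a w') (ell x w').+1 else slen a w'
  else 0.

(* Every letter in {1, a} is replaced by the previous one; the bit [u] stores it. *)
Fixpoint step (a : nat) (u : bool) (w : seq nat) : seq nat :=
  if w is x :: w' then
    if (x == 1) || (x == a) then (if u then a else 1) :: step a (x == a) w'
    else x :: step a u w'
  else [::].

Lemma ell_anti a b w : a <= b -> ell b w <= ell a w.
Proof.
elim: w a b => //= x w IH a b ab.
have := IH a b ab; case: (ltnP b x) => bx; case: (ltnP a x) => ax; lia.
Qed.

Lemma ell_le_slen a w : 0 < a -> ell a w <= slen a w.
Proof.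
move=> a0; elim: w => //= x w IH; case: eqP => [->|_].
  by case: ltnP => //; lia.
by case: ltnP => _ //; lia.
Qed.

Lemma ell_step a b u w : 0 < b -> a <= b -> ell b (step a u w) = ell b w.
Proof.
elim: w u b => //= x w IH u b b0 ab.
case: ifP => [/orP xe|xe] /=.
- have -> : (b < (if u then a else 1)) = false by case: (u); lia.
  have -> : (b < x) = false by case: xe => /eqP->; lia.
  by rewrite IH.
- by rewrite IH //; case: ltnP => // bx; rewrite IH //; lia.
Qed.

(** One row of Hammersley's process: each row point pulls the next source back to itself, and an
    incoming bit then swallows the first source. The two identities need a joint induction, since
    passing an event letter resets the bit. *)
Lemma slen_step a w : 0 < a ->
  slen a.+1 (step a.+1 false w) = slen a w /\
  (slen a.+1 (step a.+1 true w)).+1 = maxn (slen a w) (ell a.+1 w).+1.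
Proof.
move=> a0; elim: w => [|x w [IH0 IH1]] //=.
have e1 : ell a.+1 w <= slen a w.
  by apply: leq_trans (ell_le_slen w a0); apply: ell_anti.
case: (eqVneq x 1) => [->|x1] /=.
  have -> : (1 == a.+1) = false by lia.
  have -> : (a.+1 == 1) = false by lia.
  by rewrite ltnn IH0; split=> //; lia.
case: (eqVneq x a.+1) => [->|xa] /=.
  have -> : (a.+1 == 1) = false by lia.
  by rewrite ltnSn ltnn; split; lia.
rewrite (negbTE x1).
case: (ltnP a.+1 x) => ax; last first.
  by rewrite IH0; have -> : (a < x) = false; [lia | split; lia].
have -> : (a < x) by lia.
rewrite !ell_step ?IH0; [|lia..].
have := ell_anti w (ltnW ax); split; lia.
Qed.

(** A chain above [a] that uses the letter [a.+1] starts with it, hence lies in [w]; any other chain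
    stays above [a.+1]. *)
Lemma ell_cat_row a (J w : seq nat) : a.+1 \notin J ->
  ell a (J ++ w) = maxn (ell a.+1 (J ++ w)) (ell a w).
Proof.
elim: J => [|x J IH] /=.
  by move=> _; have := ell_anti w (leqnSn a); lia.
rewrite inE negb_or => /andP[xa /IH IHJ].
case: (ltnP a.+1 x) => ax.
  by have -> : (a < x); [lia | rewrite IHJ; lia].
by have -> : (a < x) = false; [lia | rewrite IHJ; lia].
Qed.

Lemma ell_le_cat a J w : ell a w <= ell a (J ++ w).
Proof. by elim: J => //= x J IH; case: ifP => _ //; lia. Qed.

Lemma ell_cat_step a b u J w : 0 < b -> a <= b ->
  ell b (J ++ step a u w) = ell b (J ++ w).
Proof.
elim: J b => /= [|x J IH] b b0 ab; first exact: ell_step.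
by rewrite IH //; case: ltnP => // bx; rewrite IH //; lia.
Qed.

(** Sinks stand in front of the word and sources below all rows, so a chain may use only one of the
    two kinds; hence the maximum. *)
Definition height a w J := maxn (slen a w) (ell a (J ++ w)).

(* The bits of [J], one per row, are the sinks; [J] lists the rows that carry one, 0 elsewhere. *)
Lemma height_step a (w J : seq nat) u : 0 < a -> all (fun y => (y == 0) || (a.+1 < y)) J ->
  height a w ((if u then a.+1 else 0) :: J) = u + height a.+1 (step a.+1 u w) J.
Proof.
move=> a0 aJ.
have nJ : a.+1 \notin J.
  by apply/negP => /(allP aJ) /=; rewrite ltnn.
have eJ v : ell a.+1 (J ++ step a.+1 v w) = ell a.+1 (J ++ w) by rewrite ell_cat_step.
have [s0 s1] := slen_step w a0.
have el := ell_le_slen w a0.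
have el' := ell_le_cat a.+1 J w.
have ec := ell_cat_row w nJ.
rewrite /height; case: u => /=.
  rewrite ltnSn ec eJ; lia.
by rewrite ec eJ s0; lia.
Qed.

Lemma slen_bd_count a (w : seq nat) : all (fun x => x <= a) w -> slen a w = count_mem 1 w.
Proof.
elim: w => //= x w IH /andP[xa /IH ->].
have -> : (a < x) = false by lia.
by case: eqP.
Qed.

Lemma ell_bd0 a (w : seq nat) : all (fun x => x <= a) w -> ell a w = 0.
Proof.
elim: w => //= x w IH /andP[xa /IH ->].
have -> // : (a < x) = false by lia.
Qed.

(** A chain loses at most the blanked letter itself. This bounded effect feeds the variance
    bounds. *)
Lemma ell_del a w1 x w2 :
  ell a (w1 ++ 0 :: w2) <= ell a (w1 ++ x :: w2) <= (ell a (w1 ++ 0 :: w2)).+1.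
Proof.
elim: w1 a => [|y w1 IH] a /=.
  case: ltnP => [ax|]; last by lia.
  have := ell_anti w2 (ltnW ax); lia.
have := IH a; have := IH y; case: ltnP; lia.
Qed.

Lemma slen_del a w1 x w2 : 0 < a ->
  slen a (w1 ++ 0 :: w2) <= slen a (w1 ++ x :: w2) <= (slen a (w1 ++ 0 :: w2)).+1.
Proof.
move=> a0; elim: w1 => [|y w1 IH] /=.
  case: eqP => [_|_]; first by lia.
  case: ltnP => [ax|]; last by lia.
  have := ell_anti w2 (ltnW ax); have := ell_le_slen w2 a0; lia.
have := ell_del y w1 x w2; case: eqP => _; first by lia.
by case: ltnP; lia.
Qed.

Lemma ell_src0 a w1 w2 : 0 < a -> ell a (w1 ++ 1 :: w2) = ell a (w1 ++ 0 :: w2).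
Proof.
elim: w1 a => [|y w1 IH] a a0 /=.
  by have -> : (a < 1) = false by lia.
by case: ltnP => ay; rewrite !IH //; lia.
Qed.

(** A source counts only for chains that leave the sources after it. A second source rewards leaving
    late, so each source is worth at least as much in the presence of the other. Convexity in the
    source density rests on this. *)
Lemma slen_supermodular a w1 w2 w3 : 0 < a ->
  slen a (w1 ++ 1 :: w2 ++ 0 :: w3) + slen a (w1 ++ 0 :: w2 ++ 1 :: w3) <=
  slen a (w1 ++ 0 :: w2 ++ 0 :: w3) + slen a (w1 ++ 1 :: w2 ++ 1 :: w3).
Proof.
move=> a0.
elim: w1 => [|y w1 IH] /=.
  by lia.
case: eqP => _; first by lia.
case: ltnP => ay //.
have y0 : 0 < y by lia.
(* Once a chain has reached the row letter [y], sources are no better than blanks. *)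
have e u v : u < 2 -> v < 2 -> ell y (w1 ++ u :: w2 ++ v :: w3)
    = ell y (w1 ++ 0 :: w2 ++ 0 :: w3).
  move=> u2 v2.
  have -> : ell y (w1 ++ u :: w2 ++ v :: w3) = ell y (w1 ++ 0 :: w2 ++ v :: w3).
    by case: u u2 => [|[|]] // _; rewrite ell_src0.
  case: v v2 => [|[|]] // _.
  by have := ell_src0 (w1 ++ 0 :: w2) w3 y0; rewrite -!catA.
rewrite !(e 1 0) // !(e 0 1) // !(e 1 1) // .
have := slen_del (w1 ++ 0 :: w2) 1 w3 a0; rewrite -!catA /=.
have := slen_del (w1) 1 (w2 ++ 0 :: w3) a0.
have := slen_del (w1) 1 (w2 ++ 1 :: w3) a0.
lia.
Qed.

Lemma ell_slen_nosrc a (w : seq nat) : 0 < a -> 1 \notin w -> slen a w = ell a w.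
Proof.
move=> a0; elim: w => //= x w IH; rewrite inE negb_or eq_sym => /andP[/negbTE-> /IH ->] //.
Qed.

Lemma ell_ge a (v w : seq nat) : subseq v w -> path ltn a v -> size v <= ell a w.
Proof.
elim: w a v => [|x w IH] a [|y v] //=.
case: eqP => [<-|_] sub /andP[ay pv].
  by rewrite ay; have := IH _ _ sub pv; lia.
have := IH a (y :: v) sub; rewrite /= ay pv => /(_ isT).
by case: ifP => _; lia.
Qed.

Lemma ell_witness a (w : seq nat) : exists v : seq nat, [/\ subseq v w, path ltn a v & size v = ell a w].
Proof.
elim: w a => [|x w IH] a /=; first by exists [::].
have [v1 [s1 p1 e1]] := IH a.
have nu : exists v, [/\ subseq v (x :: w), path ltn a v & size v = ell a w].
  by exists v1; split=> //; apply: subseq_trans s1 (subseq_cons _ _).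
case: ltnP => [ax|_]; last exact: nu.
case: (leqP (ell x w).+1 (ell a w)) => _; first exact: nu.
have [v2 [s2 p2 e2]] := IH x.
exists (x :: v2); split=> /=; rewrite ?eqxx ?ax ?e2 ?s2 ?p2 //.
Qed.

(** Links of the chains counted by [slen]: a source may be followed by another source or by any row
    letter. *)
Definition srel (x y : nat) := if x == 1 then 0 < y else x < y.

Lemma srel_ltn x v : 1 < x -> path srel x v -> path ltn x v.
Proof.
elim: v x => //= y v IH x x1 /andP[]; rewrite /srel.
have -> : (x == 1) = false by lia.
move=> xy pv; rewrite xy IH //; lia.
Qed.

Lemma slen_ge (v w : seq nat) : subseq v w -> path srel 1 v -> size v <= slen 1 w.
Proof.
elim: w v => [|x w IH] [|y v] //=.
case: (eqVneq y x) => [<-|_] sub.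
  case/andP; rewrite {1}/srel eqxx => y0 pv.
  case: eqP => [y1|y1]; first by rewrite y1 in pv; have := IH _ sub pv; lia.
  have y2 : 1 < y by lia.
  by rewrite y2; have := ell_ge sub (srel_ltn y2 pv); lia.
move=> pv; have := IH (y :: v) sub pv => /=.
by case: ifP => _; [lia | case: ifP => _; lia].
Qed.

(** * Upper bound: cyclic shifts *)

(** The bit stored when [step] reaches the end of the word; feeding it in at the start makes the
    shift cyclic. *)
Fixpoint lastbit (a : nat) (u : bool) (w : seq nat) : bool :=
  if w is x :: w' then
    if (x == 1) || (x == a) then lastbit a (x == a) w' else lastbit a u w'
  else u.

Definition is_event (a x : nat) := (x == 1) || (x == a).

(** Sum of the ranks, counted from [j], of the letters [a] within the subword on [1] and [a]. *)
Fixpoint pos (a j : nat) (w : seq nat) : nat :=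
  if w is x :: w' then
    if (x == 1) || (x == a) then (x == a) * j + pos a j.+1 w' else pos a j w'
  else 0.

Definition cyc a w := step a (lastbit a false w) w.

Lemma lastbit_idem a u w : lastbit a (lastbit a u w) w = lastbit a u w.
Proof.
by elim: w u => //= x w IH u; case: (_ || _) => /=; rewrite ?IH.
Qed.

(** The shift raises every rank by one; the incoming bit enters at rank [j], and the outgoing one
    would sit just past the last event. *)
Lemma pos_step a u w j : a != 1 ->
  pos a j (step a u w) + lastbit a u w * (j + count (is_event a) w)
    = u * j + pos a j.+1 w.
Proof.
move=> a1; elim: w u j => [|x w IH] u j /=; first by rewrite !addn0.
rewrite {1}/is_event; case: ifP => [_|e] /=.
  have := IH (x == a) j.+1.
  by case: u; rewrite ?eqxx ?orbT ?(negbTE a1) ?(eq_sym 1) ?(negbTE a1) /=; lia.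
by rewrite e IH.
Qed.

Lemma posS a w j : a != 1 -> pos a j.+1 w = pos a j w + count_mem a w.
Proof.
move=> a1; elim: w j => //= x w IH j.
case: ifP => [_|/norP[_ /negbTE->]]; rewrite !IH //; lia.
Qed.

(* Averaged over a [cyc]-invariant law, the two [pos] terms cancel and this gives the mean of [lastbit]. *)
Lemma pos_cyc a w : a != 1 ->
  pos a 0 (cyc a w) + lastbit a false w * count (is_event a) w
    = pos a 0 w + count_mem a w.
Proof.
move=> a1; have := pos_step (lastbit a false w) w 0 a1.
by rewrite lastbit_idem -posS // muln0.
Qed.

Lemma perm_step a u w :
  perm_eq ((if u then a else 1) :: w) ((if lastbit a u w then a else 1) :: step a u w).
Proof.
elim: w u => //= x w IH u; case xe: (_ || _) => /=.
  have {1}-> : x = (if x == a then a else 1).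
    by case/orP: xe => /eqP ->; rewrite ?eqxx //; case: eqP.
  rewrite -cat1s perm_sym -cat1s -(cat1s (if u then _ else _)) perm_catCA /=.
  by rewrite perm_cons perm_sym IH.
rewrite -cat1s -(cat1s x) perm_catCA perm_sym.
rewrite -cat1s -(cat1s x) perm_catCA /= perm_cons perm_sym; exact: IH.
Qed.

Lemma perm_cyc a w : perm_eq (cyc a w) w.
Proof.
by have := perm_step a (lastbit a false w) w; rewrite lastbit_idem perm_cons perm_sym.
Qed.

(** Each event letter can be read off at the next event of the image, and the last one from the
    outgoing bit. *)
Lemma step_inj a u1 u2 w1 w2 : a != 1 ->
  step a u1 w1 = step a u2 w2 -> lastbit a u1 w1 = lastbit a u2 w2 ->
  u1 = u2 /\ w1 = w2.
Proof.
move=> a1; elim: w1 u1 u2 w2 => [|x w1 IH] u1 u2 [|y w2] //=.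
- by case: ifP.
- by case: ifP.
have out u : is_event a (if u then a else 1).
  by rewrite /is_event; case: u; rewrite eqxx ?orbT.
rewrite -/(is_event a x) -/(is_event a y).
case ex: (is_event a x); case ey: (is_event a y).
- move=> [eu es] el; have [exy ->] := IH _ _ _ es el.
  split; first by move: eu; case: (u1); case: (u2) => // /eqP; rewrite ?(eq_sym 1) (negbTE a1).
  congr cons; move: ex ey exy; rewrite /is_event; case: (eqVneq x a) => [->|]; case: (eqVneq y a) => [->|] //.
  by move=> _ _; rewrite !orbF => /eqP-> /eqP->.
- by move=> [eu _]; rewrite -eu out in ey.
- by move=> [eu _]; rewrite eu out in ex.
by move=> [-> es] el; have [-> ->] := IH _ _ _ es el.
Qed.

(** With bit 0 the row preserves the length; with bit 1 the second identity of [slen_step] shows a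
    loss of at most one. *)
Lemma slen_le_cyc a w : 0 < a ->
  slen a w <= lastbit a.+1 false w + slen a.+1 (cyc a.+1 w).
Proof.
move=> a0; have [s0 s1] := slen_step w a0.
by rewrite /cyc; case: lastbit; lia.
Qed.

Lemma lastbit_noevent a u w : ~~ has (is_event a) w -> lastbit a u w = u.
Proof. by elim: w => //= x w IH /norP[]; rewrite /is_event => /negbTE-> /IH. Qed.

Lemma head_step a u w :
  head (if u then a else 1) (filter (is_event a) (step a u w)) = if u then a else 1.
Proof.
elim: w => //= x w IH; rewrite -/(is_event a x); case e: (is_event a x) => /=; last by rewrite e IH.
have -> // : is_event a (if u then a else 1).
by rewrite /is_event; case: u {IH}; rewrite eqxx ?orbT.
Qed.

(** The first event letter of the image reveals the incoming bit, which for [cyc] is also the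
    outgoing one, so [step_inj] applies. Without events both bits are 0. *)
Lemma cyc_inj a : a != 1 -> injective (cyc a).
Proof.
move=> a1 w1 w2 e.
have [|//] := step_inj a1 e; rewrite !lastbit_idem.
have := head_step a (lastbit a false w1) w1.
have := head_step a (lastbit a false w2) w2.
rewrite -!/(cyc a _) e; case E: [seq x <- cyc a w2 | is_event a x] => [|y r] /=.
  have noev w : perm_eq (cyc a w2) w -> ~~ has (is_event a) w.
    by move=> /(perm_filter (is_event a)); rewrite has_filter E perm_sym => /perm_nilP ->.
  by rewrite !lastbit_noevent // noev // ?perm_cyc // -e perm_cyc.
move=> ->; case: lastbit; case: lastbit => // /eqP; rewrite ?(eq_sym 1) (negbTE a1) //.
Qed.

(** * Rearrangements of words and averages over orbits *)

Definition wordl T (y : 'I_T -> nat) : seq nat := [seq y i | i <- enum 'I_T].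

Definition relabel T (A : Type) (x : {ffun 'I_T -> A}) (p : 'S_T) : {ffun 'I_T -> A} :=
  [ffun i => x (p i)].

Lemma size_wordl T (y : 'I_T -> nat) : size (wordl y) = T.
Proof. by rewrite size_map size_enum_ord. Qed.

Lemma nth_wordl T (y : 'I_T -> nat) (i : 'I_T) : nth 0 (wordl y) i = y i.
Proof. by rewrite (nth_map i) ?size_enum_ord // nth_ord_enum. Qed.

Definition fword T d (x : {ffun 'I_T -> 'I_d}) := wordl (fun i => x i).

Lemma fword_relabel T d (x : {ffun 'I_T -> 'I_d}) (p : 'S_T) :
  fword (relabel x p) = wordl (fun i => x (p i)).
Proof. by apply: eq_map => i /=; rewrite ffunE. Qed.

Lemma fword_inj T d : injective (@fword T d).
Proof.
move=> x y e; apply/ffunP => i; apply: val_inj.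
by have := nth_wordl (fun i => x i) i; rewrite -/(fword x) e nth_wordl.
Qed.

Lemma perm_wordlP T (y z : 'I_T -> nat) :
  perm_eq (wordl y) (wordl z) -> exists p : 'S_T, y =1 z \o p.
Proof.
move=> e; have sy := size_wordl y; have sz := size_wordl z.
have /tuple_permP [p pE] : perm_eq (wordl y) (Tuple (introT eqP sz)) by [].
exists p => i; rewrite -(nth_wordl y) pE /= -[RHS](nth_wordl z).
rewrite (nth_map i) ?size_enum_ord //.
by rewrite (tnth_nth 0) /= nth_ord_enum.
Qed.

Lemma perm_wordl T (y : 'I_T -> nat) (p : 'S_T) :
  perm_eq (wordl (fun i => y (p i))) (wordl y).
Proof.
rewrite /wordl (map_comp y p); apply: perm_map; apply: uniq_perm.
- by rewrite (map_inj_uniq (@perm_inj _ p)) enum_uniq.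
- exact: enum_uniq.
by move=> i; rewrite mem_enum -[i](permKV p) map_f // mem_enum.
Qed.

Lemma relabelM T (A : Type) (x : {ffun 'I_T -> A}) (p q : 'S_T) :
  relabel (relabel x p) q = relabel x (q * p)%g.
Proof. by apply/ffunP => i; rewrite !ffunE permM. Qed.

Lemma relabel_inj T (A : eqType) (q : 'S_T) : injective (fun x : {ffun 'I_T -> A} => relabel x q).
Proof.
move=> x y /ffunP e; apply/ffunP => i; have := e (q^-1 i)%g.
by rewrite !ffunE permKV.
Qed.

Section Orbit.
Variables (T : nat) (A : finType) (W : {set {ffun 'I_T -> A}}) (x : {ffun 'I_T -> A}).
Hypothesis W_stable : forall t p, (relabel t p \in W) = (t \in W).
Hypothesis W_orbit : forall t, t \in W -> exists p, t = relabel x p.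

(** Double counting over pairs of a word in [W] and a permutation: the inner sum is constant
    whichever variable is fixed. *)
Lemma orbit_avg (F : {ffun 'I_T -> A} -> nat) :
  (\sum_(t in W) F t) * T`! = #|W| * \sum_(p : 'S_T) F (relabel x p).
Proof.
have e1 (p : 'S_T) : \sum_(t in W) F (relabel t p) = \sum_(t in W) F t.
  rewrite [RHS](reindex_inj (@relabel_inj T A p)) /=.
  by apply: eq_bigl => t; rewrite W_stable.
have e2 t : t \in W -> \sum_(p : 'S_T) F (relabel t p) = \sum_(p : 'S_T) F (relabel x p).
  case/W_orbit => q ->; rewrite [RHS](reindex_inj (mulIg q)) /=.
  by apply: eq_bigr => p _; rewrite relabelM.
transitivity (\sum_(p : 'S_T) \sum_(t in W) F (relabel t p)).
  by rewrite (eq_bigr _ (fun p _ => e1 p)) sum_nat_const card_Sn mulnC.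
by rewrite exchange_big /= (eq_bigr _ e2) sum_nat_const.
Qed.
End Orbit.

Section Ring.
Variables (T n k m : nat) (x : {ffun 'I_T -> 'I_n.+2}).
Hypothesis count1 : count_mem 1 (fword x) = m.
Hypothesis count_row : forall a, 1 < a -> count_mem a (fword x) <= k.

Let W := [set t : {ffun 'I_T -> 'I_n.+2} | perm_eq (fword t) (fword x)].

Lemma ring_orbit_avg (F : seq nat -> nat) :
  (\sum_(t in W) F (fword t)) * T`! = #|W| * \sum_(p : 'S_T) F (wordl (fun i => x (p i))).
Proof.
rewrite (@orbit_avg _ _ W x _ _ (fun t => F (fword t))).
- by congr (_ * _); apply: eq_bigr => p _; rewrite fword_relabel.
- move=> t p; rewrite !inE fword_relabel.
  by apply: permPl; apply: (perm_wordl (fun i => t i)).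
move=> t; rewrite inE => /perm_wordlP[p pE]; exists p.
by apply/ffunP => i; apply: val_inj; rewrite ffunE; apply: pE.
Qed.

Definition cycf a (t : {ffun 'I_T -> 'I_n.+2}) : {ffun 'I_T -> 'I_n.+2} :=
  [ffun i : 'I_T => inord (nth 0 (cyc a (fword t)) i)].

Lemma fword_lt d (t : {ffun 'I_T -> 'I_d}) : all (fun y => y < d) (fword t).
Proof. by apply/allP => y /mapP[i _ ->]. Qed.

Lemma fword_cycf a t : fword (cycf a t) = cyc a (fword t).
Proof.
have pc := perm_cyc a (fword t).
have sz : size (cyc a (fword t)) = T by rewrite (perm_size pc) size_wordl.
apply: (@eq_from_nth _ 0); first by rewrite size_wordl sz.
move=> i; rewrite size_wordl => iT.
rewrite (nth_wordl _ (Ordinal iT)) ffunE /= inordK //.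
apply: (allP (fword_lt t)); rewrite -(perm_mem pc) mem_nth // sz //.
Qed.

Lemma sum_cycf a (F : seq nat -> nat) : a != 1 ->
  \sum_(t in W) F (cyc a (fword t)) = \sum_(t in W) F (fword t).
Proof.
move=> a1; have cinj : injective (cycf a).
  move=> t1 t2 e; apply: fword_inj; apply: (cyc_inj a1).
  by rewrite -!fword_cycf e.
rewrite [RHS](reindex_inj cinj) /=; apply: eq_big => [t|t _].
  by rewrite !inE fword_cycf (permPl (perm_cyc _ _)).
by rewrite fword_cycf.
Qed.

(** Since [cyc] permutes the rearrangements [W], summing [pos_cyc] leaves [U * (m + c) = #|W| * c],
    where [c <= k] is the number of letters [a]. *)
Lemma sum_lastbit a : 1 < a ->
  (k + m) * \sum_(t in W) lastbit a false (fword t) <= #|W| * k.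
Proof.
move=> a2; have a1 : a != 1 by lia.
set U := \sum_(t in W) _.
have cW t z : t \in W -> count z (fword t) = count z (fword x).
  by rewrite inE => /seq.permP ->.
have ev : count (is_event a) (fword x) = m + count_mem a (fword x).
  rewrite -count1 -count_predUI [X in _ + X](eq_count (a2 := pred0)).
    by rewrite count_pred0 addn0.
  by move=> y /=; case: (eqVneq y 1) => // ->; rewrite eq_sym (negbTE a1).
have UW : U <= #|W|.
  by rewrite -sum1_card; apply: leq_sum => t _; case: lastbit.
have : U * (m + count_mem a (fword x)) = #|W| * count_mem a (fword x).
  have : \sum_(t in W) (pos a 0 (cyc a (fword t)) + lastbit a false (fword t) * count (is_event a) (fword t))
     = \sum_(t in W) (pos a 0 (fword t) + count_mem a (fword t)).
    by apply: eq_bigr => t _; rewrite pos_cyc.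
  rewrite !big_split /= (sum_cycf (pos a 0) a1) => /addnI.
  rewrite (eq_bigr (fun t => (lastbit a false (fword t) : nat) * (m + count_mem a (fword x)))); last first.
    by move=> t tW; rewrite cW // ev.
  rewrite -big_distrl /= => ->.
  rewrite (eq_bigr (fun=> count_mem a (fword x))) ?sum_nat_const //.
  by move=> t tW; rewrite cW.
(* Here [(k + m) * U = U * (m + c) + U * (k - c)], and [U <= #|W|] bounds the last term. *)
have := count_row a2; move: (count_mem a _) => c ck.
nia.
Qed.

(** Descends from the top: above all rows only the [m] sources count, and each further row costs one
    mean bit. *)
Lemma sum_slen_row i : i <= n ->
  (k + m) * \sum_(t in W) slen (n - i).+1 (fword t) <= #|W| * (m * (k + m) + i * k).
Proof.
elim: i => [_|i IH lin].
  rewrite subn0 (eq_bigr (fun=> m)); first by rewrite sum_nat_const; lia.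
  move=> t tW; rewrite slen_bd_count; last exact: fword_lt.
  by move: tW; rewrite inE => /seq.permP ->.
have := IH (ltnW lin); set b := n - i => IHb.
have -> : (n - i.+1).+1 = b by lia.
have b0 : 0 < b by lia.
have lb := @sum_lastbit b.+1 (ltac:(lia)).
have le : \sum_(t in W) slen b (fword t) <=
    \sum_(t in W) lastbit b.+1 false (fword t) + \sum_(t in W) slen b.+1 (fword t).
  rewrite -(sum_cycf (slen b.+1) (a := b.+1)) -?big_split /=; last by lia.
  by apply: leq_sum => t _; apply: slen_le_cyc.
apply: leq_trans (leq_mul (leqnn (k + m)) le) _; rewrite mulnDr.
nia.
Qed.

Lemma ring_bound :
  (k + m) * \sum_(p : 'S_T) slen 1 (wordl (fun i => x (p i))) <= T`! * (m * (k + m) + n * k).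
Proof.
have W0 : 0 < #|W| by apply/card_gt0P; exists x; rewrite inE.
have := sum_slen_row (leqnn n); rewrite subnn => H.
rewrite -(leq_pmul2l W0) mulnCA -ring_orbit_avg.
by rewrite mulnA [X in _ <= X]mulnCA [X in _ <= X]mulnC leq_mul2r H orbT.
Qed.
End Ring.

(** * Multiset permutations as rearrangements of the sorted word *)

Lemma count_divn k b T : 0 < k ->
  count_mem b [seq i %/ k | i <- iota 0 T] = minn T (b.+1 * k) - minn T (b * k).
Proof.
move=> k0; elim: T => [|T IH]; first by rewrite !min0n.
rewrite -addn1 iotaD map_cat count_cat IH /= addn0 add0n.
have -> : (T %/ k == b) = (b * k <= T < b.+1 * k).
  by rewrite eqn_leq andbC -leq_divRL // -ltn_divLR // ltnS.
lia.
Qed.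

Lemma base_lt k n (i : 'I_(k * n)) : i %/ k < n.
Proof.
move: (nat_of_ord i) (ltn_ord i) => c; case: (posnP k) => [->|k0]; first by rewrite mul0n.
by rewrite ltn_divLR // mulnC.
Qed.

Definition base k n : word (k * n) n := [ffun i => Ordinal (base_lt i)].

Lemma wordl_val T (g : nat -> nat) : wordl (fun i : 'I_T => g i) = [seq g i | i <- iota 0 T].
Proof. by rewrite /wordl -val_enum_ord -map_comp. Qed.

Lemma fword_base k n : fword (base k n) = [seq i %/ k | i <- iota 0 (k * n)].
Proof.
rewrite -(wordl_val (k * n) (divn^~ k)); apply: eq_map => i; rewrite ffunE //.
Qed.

Lemma count_wordl T (P : pred nat) (y : 'I_T -> nat) :
  count P (wordl y) = #|[set i | P (y i)]|.
Proof.
by rewrite /wordl count_map cardsE cardE [in RHS]/enum_mem size_filter -enumT; apply: eq_count.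
Qed.

Lemma is_kpermE k n (s : word (k * n) n) : is_kperm s = perm_eq (fword s) (fword (base k n)).
Proof.
have cs (t : word (k * n) n) (a : 'I_n) : #|[set i | t i == a]| = count_mem (a : nat) (fword t).
  by rewrite /fword (count_wordl (pred1 (a : nat))); apply: eq_card => i; rewrite !inE.
have cb (a : 'I_n) : count_mem (a : nat) (fword (base k n)) = k.
  case: (posnP k) => [k0|k0].
    have := count_size (pred1 (a : nat)) (fword (base k n)).
    by rewrite size_wordl [X in _ <= X](_ : _ = 0) ?k0 // leqn0 => /eqP.
  rewrite fword_base count_divn //; have := ltn_ord a; nia.
apply/forallP/idP => [H|/seq.permP e a]; last by rewrite cs e cb.
apply/allP => y _; apply/eqP.
case: (ltnP y n) => yn.
  apply: etrans (esym (cb (Ordinal yn))); rewrite -(cs s (Ordinal yn)); exact/eqP/H.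
have z (t : word (k * n) n) : count_mem y (fword t) = 0.
  apply/eqP; rewrite -leqn0 leqNgt -has_count; apply/hasPn => u /mapP[i _ ->] /=.
  by have := ltn_ord (t i); lia.
by rewrite !z.
Qed.

Lemma kperm_avg k n :
  (\sum_(s : word (k * n) n | is_kperm s) Llt s) * (k * n)`! =
  #|[set s : word (k * n) n | is_kperm s]| * \sum_(p : 'S_(k * n)) Llt (relabel (base k n) p).
Proof.
rewrite -(@orbit_avg _ _ [set s : word (k * n) n | is_kperm s] (base k n) _ _ (@Llt _ _)).
- by congr (_ * _); apply: eq_bigl => s; rewrite inE.
- move=> t p; rewrite !inE !is_kpermE fword_relabel.
  by apply: permPl; apply: (perm_wordl (fun i => t i)).
move=> t; rewrite inE is_kpermE => /perm_wordlP[p pE]; exists p.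
by apply/ffunP => i; apply: val_inj; rewrite ffunE; apply: pE.
Qed.

(** As an average over permutations of the positions, the mean can be compared with that of other
    words under the same permutation. *)
Lemma ELlt_avg (R : realType) k n :
  ELlt R k n = ((\sum_(p : 'S_(k * n)) Llt (relabel (base k n) p))%:R / ((k * n)`!)%:R)%R.
Proof.
rewrite /ELlt -natr_sum.
set W := [set s : word (k * n) n | is_kperm s].
have W0 : (#|W|%:R != 0 :> R)%R.
  rewrite pnatr_eq0 -lt0n; apply/card_gt0P; exists (base k n).
  by rewrite inE is_kpermE.
have f0 : ((k * n)`!%:R != 0 :> R)%R by rewrite pnatr_eq0 -lt0n fact_gt0.
by apply/eqP; rewrite eqr_div // -!natrM kperm_avg mulnC.
Qed.

Lemma strict_chain_sorted m n (s : word m n) (A : {set 'I_m}) :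
  strict_chain s A -> sorted (fun i j => s i < s j) (enum A).
Proof.
move=> /forall_inP cA.
have sA : sorted (fun i j : 'I_m => i < j) (enum A).
  rewrite {1}/enum_mem; apply: sorted_filter; first by move=> x y z; apply: ltn_trans.
  by have := iota_ltn_sorted 0 m; rewrite -val_enum_ord sorted_map enumT.
apply: (@sub_in_sorted _ (mem A) (fun i j : 'I_m => i < j)) sA; last first.
  by apply/allP => i; rewrite mem_enum.
by move=> i j iA jA ij; have /forall_inP/(_ j jA)/implyP := cA i iA; apply.
Qed.

(** Turning the items of rank below [m] into sources only relaxes the constraints on a chain. Row
    letters start at 2, after blank and source. *)
Lemma Llt_le_slen k n m (p : 'S_(k * n)) :
  Llt (relabel (base k n) p) <=
  slen 1 (wordl (fun i => if p i < m then 1 else (p i %/ k).+2)).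
Proof.
apply/bigmax_leqP => A /strict_chain_sorted sA.
set y := fun i => _.
rewrite cardE -(size_map y).
apply: slen_ge.
  by apply: map_subseq; rewrite {1}/enum_mem enumT filter_subseq.
have : sorted srel [seq y i | i <- enum A].
  rewrite sorted_map; apply: sub_sorted sA => i j /=; rewrite !ffunE /= => ij.
  rewrite /srel /y; case: (ltnP (p j) m) => jm; case: ltnP => im //=.
  (* A source after a row point has smaller rank, hence no larger letter, against strict
     increase. *)
  by have := leq_div2r k (leq_trans (ltnW jm) im); lia.
case E: [seq y i | i <- enum A] => [|z r] //= ->.
suff: 0 < z by rewrite /srel /= => ->.
have /mapP[i _ ->] : z \in [seq y i | i <- enum A] by rewrite E mem_head.
by rewrite /y; case: ifP.
Qed.

Lemma pairwise_mem (A : eqType) (r1 r2 : rel A) (l : seq A) i j :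
  pairwise r1 l -> pairwise r2 l -> (forall i j, r1 i j -> ~~ r1 j i) ->
  i \in l -> j \in l -> r1 i j -> r2 i j.
Proof.
move=> p1 p2 as1; elim: l p1 p2 => //= x l IH /andP[a1 p1] /andP[a2 p2].
rewrite !inE => /predU1P[->|il] /predU1P[->|jl] rij.
- by have := as1 _ _ rij; rewrite rij.
- exact: (allP a2).
- by have := as1 _ _ rij; rewrite (allP a1).
exact: IH.
Qed.

(** The map [f] may merge letters: a strict increase of the images still forces one of the letters,
    and [ell 1] ignores the unconstrained positions. *)
Lemma ell_le_Llt m n (s : word m n) (y : 'I_m -> nat) (f : 'I_n -> nat) :
  (forall i, 1 < y i -> y i = f (s i)) -> (forall a b, f a < f b -> a < b) ->
  ell 1 (wordl y) <= Llt s.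
Proof.
move=> yf fm; have [v [/subseqP[b sb vE] pv <-]] := ell_witness 1 (wordl y).
move: vE; rewrite /wordl -map_mask; set l := mask b _ => vE.
have lu : uniq l by rewrite mask_uniq // enum_uniq.
have -> : size v = #|[set i in l]|.
  by rewrite vE size_map -(card_uniqP lu) cardsE.
apply: (@leq_bigmax_cond _ (fun A => strict_chain s A) (fun A => #|A|)).
have yl i : i \in l -> y i = f (s i).
  move=> il; apply: yf.
  have : y i \in v by rewrite vE map_f.
  by move: pv; rewrite (path_sortedE ltn_trans) => /andP[/allP H _] /H.
have pl : pairwise (fun i j : 'I_m => i < j) l.
  apply: (@subseq_pairwise _ _ _ (enum 'I_m)); first exact: mask_subseq.
  by rewrite -(pairwise_map val ltn) val_enum_ord -(sorted_pairwise ltn_trans) iota_ltn_sorted.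
have pl2 : pairwise (fun i j : 'I_m => y i < y j) l.
  rewrite -(pairwise_map y ltn) -vE -(sorted_pairwise ltn_trans).
  exact: path_sorted pv.
apply/forall_inP => i; rewrite inE => il; apply/forall_inP => j; rewrite inE => jl.
apply/implyP => ij; apply: fm; rewrite -!yl //.
apply: (pairwise_mem pl pl2 _ il jl ij) => a c ac; rewrite -leqNgt; exact: ltnW.
Qed.

Definition blank_out (B : pred nat) (w : seq nat) := [seq (if B x then 0 else x) | x <- w].

(** A strictly increasing chain uses each letter at most once, so it loses at most one item per
    blanked letter value. *)
Lemma ell_blank_out (B : pred nat) N (w : seq nat) : all (fun x => x < N.+2) w ->
  ell 1 w <= ell 1 (blank_out B w) + count B (iota 2 N).
Proof.
move=> wN; have [v [sv pv <-]] := ell_witness 1 w.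
have : path ltn 1 (filter (predC B) v).
  move: pv; rewrite !(path_sortedE ltn_trans) => /andP[av sov].
  rewrite sorted_filter ?andbT //; last exact: ltn_trans.
  by apply/allP => x; rewrite mem_filter => /andP[_ /(allP av)].
have sub : subseq (filter (predC B) v) (blank_out B w).
  apply: (@subseq_trans _ (filter (predC B) w)).
    by rewrite subseq_filter filter_all (subseq_trans (filter_subseq _ _) sv).
  elim: (w) => //= x r IH; case: (B x) => /=; last by rewrite eqxx.
  exact: subseq_trans IH (subseq_cons _ _).
move=> /(ell_ge sub); rewrite size_filter -(count_predC B v) addnC => H.
rewrite leq_add // -!size_filter; apply: uniq_leq_size.
  apply: filter_uniq; apply: (sorted_uniq ltn_trans ltnn); exact: path_sorted pv.
move=> x; rewrite !mem_filter mem_iota => /andP[-> xv] /=.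
move: pv; rewrite (path_sortedE ltn_trans) => /andP[/allP/(_ x xv) /= -> _] /=.
rewrite add2n; apply: (allP wN); exact: mem_subseq sv _ xv.
Qed.

(** * Lower bound: comparison with i.i.d. words *)

Fixpoint fill (w r : seq nat) : seq nat :=
  if w is x :: w' then
    if 1 < x then x :: fill w' r else head 0 r :: fill w' (behead r)
  else [::].

Lemma perm_fill w r : size r = count (fun x => x <= 1) w ->
  perm_eq (fill w r) (filter (leq 2) w ++ r).
Proof.
elim: w r => [|x w IH] r /=; first by move/size0nil->.
case: ltnP => x1 sr /=; first by rewrite perm_cons; apply: IH.
case: r sr => [|y r] //= sr; have /IH H : size r = count (leq^~ 1) w by lia.
rewrite -(cat1s y r) perm_sym perm_catCA /= perm_cons perm_sym.
exact: H.
Qed.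

Lemma nth_fill w r i : 1 < nth 0 w i -> nth 0 (fill w r) i = nth 0 w i.
Proof.
elim: w r i => [|x w IH] r [|i] //=; first by move=> ->.
by case: (1 < x); apply: IH.
Qed.

(** The row letters of [w] form a sub-multiset of [y]; the remaining letters of [y] fill the other
    places. *)
Lemma fill_exists (w y : seq nat) : size w = size y ->
  (forall b, 1 < b -> count_mem b w <= count_mem b y) ->
  exists2 z, perm_eq z y & forall i, 1 < nth 0 w i -> nth 0 z i = nth 0 w i.
Proof.
move=> sz cw; set X := filter (leq 2) w.
have /count_subseqP [s sy Xs] : forall b, count_mem b X <= count_mem b y.
  move=> b; rewrite count_filter; case: (ltnP 1 b) => b1.
    by apply: leq_trans (cw b b1); apply: sub_count => c /= /andP[].
  rewrite (eq_count (a2 := pred0)) ?count_pred0 // => c /=.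
  by case: eqP => // ->; lia.
have [r yr] := perm_to_subseq sy.
exists (fill w r); last by move=> i; apply: nth_fill.
have yX : perm_eq y (X ++ r) by rewrite (permPl yr) perm_cat2r perm_sym.
rewrite perm_sym (permPl yX) perm_sym; apply: perm_fill.
have := perm_size yX; rewrite size_cat -sz /X size_filter -(count_predC (leq 2) w).
by move/addnI => <-; apply: eq_count => c /=; rewrite -ltnNge.
Qed.

Section Transfer.
Variables (k n j : nat) (k0 : 0 < k) (j0 : 0 < j).
Let T := k * n.
Let K := k * j.
Let N := n %/ j.

(** Merging [j] consecutive rows of the sorted word gives [N] full rows of [K] letters, possibly
    with an incomplete one left over. There is thus room for all row letters of [y]. *)
Lemma fill_base (y : 'I_T -> nat) :
  (forall i, y i < N.+2) -> (forall b, 1 < b -> count_mem b (wordl y) <= K) ->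
  exists q : 'S_T, forall i, 1 < y i -> y i = (base k n (q i) %/ j).+2.
Proof.
move=> yN cy; set y0 := fun i : 'I_T => (i %/ K).+2.
have y0E : wordl y0 = [seq c.+2 | c <- [seq i %/ K | i <- iota 0 T]].
  by rewrite -map_comp -(wordl_val T (fun i => (i %/ K).+2)).
have K0 : 0 < K by rewrite muln_gt0 k0.
have [||z zy zw] := @fill_exists (wordl y) (wordl y0); first by rewrite !size_wordl.
  move=> [|[|b]] // _; case: (ltnP b N) => bN; last first.
    rewrite [X in X <= _](_ : _ = 0) //; apply/eqP; rewrite -leqn0 leqNgt -has_count.
    by apply/hasPn => u /mapP[i _ ->] /=; have := yN i; lia.
  apply: leq_trans (cy _ _) _ => //; rewrite y0E count_map.
  rewrite (eq_count (a2 := pred1 b)) // count_divn //.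
  have : b.+1 * K <= T.
    rewrite /K /T mulnCA leq_mul2l; apply/orP; right.
    by apply: leq_trans (leq_divM n j); rewrite leq_mul2r; apply/orP; right.
  nia.
have zE : z = wordl (fun i : 'I_T => nth 0 z i).
  rewrite (wordl_val T (nth 0 z)).
  have -> : T = size z by rewrite (perm_size zy) size_wordl.
  by rewrite -/(mkseq _ _) mkseq_nth.
rewrite zE in zy; have [q qE] := perm_wordlP zy.
exists q => i yi; have := qE i; rewrite /= /y0 ffunE /= => e.
by rewrite -divnMA -e zw nth_wordl.
Qed.

(** Overfull rows of [x] are blanked, at a cost of at most one each; what remains sits inside a
    rearrangement [q] of the merged sorted word. *)
Lemma transfer_bound (x : {ffun 'I_T -> 'I_N.+2}) :
  \sum_(p : 'S_T) ell 1 (wordl (fun i => x (p i))) <=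
  T`! * count (fun b => K < count_mem b (fword x)) (iota 2 N)
    + \sum_(p : 'S_T) Llt (relabel (base k n) p).
Proof.
set B := fun b => K < count_mem b (fword x).
pose y := fun i => if B (x i) then 0 else x i : nat.
have yN i : y i < N.+2 by rewrite /y; case: ifP.
have cy b : 1 < b -> count_mem b (wordl y) <= K.
  move=> b1; case Bb: (B b); last first.
    move/negbT: Bb; rewrite /B -leqNgt; apply: leq_trans.
    rewrite /fword !count_wordl; apply: subset_leq_card; apply/subsetP => i.
    by rewrite !inE /y /=; case: (B (x i)) => // /eqP b0; move: b1; rewrite -b0.
  rewrite [X in X <= _](_ : _ = 0) //; apply/eqP; rewrite -leqn0 leqNgt -has_count.
  apply/hasPn => u /mapP[i _ ->] /=; rewrite /y; apply/eqP.
  by case: ifP => [_|nb] e; [move: b1; rewrite -e | rewrite e Bb in nb].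
have [q qE] := fill_base yN cy.
(* Summing over all [p] absorbs [q]. *)
have <- : \sum_(p : 'S_T) Llt (relabel (relabel (base k n) q) p)
    = \sum_(p : 'S_T) Llt (relabel (base k n) p).
  rewrite [RHS](reindex_inj (mulIg q)) /=; apply: eq_bigr => p _; by rewrite relabelM.
rewrite -card_Sn -sum_nat_const -big_split /=; apply: leq_sum => p _.
rewrite addnC; apply: leq_trans (@ell_blank_out B N _ _) _.
  by apply/allP => u /mapP[i _ ->].
rewrite leq_add2r.
have -> : blank_out B (wordl (fun i => x (p i))) = wordl (fun i => y (p i)).
  by rewrite /blank_out /wordl -map_comp.
apply: (@ell_le_Llt _ _ _ _ (fun a => (a %/ j).+2)).
  by move=> i yi; rewrite !ffunE (qE _ yi) ffunE.
move=> a b; rewrite !ltnS => ab; rewrite ltnNge; apply: contraL ab => ba.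
by rewrite -leqNgt leq_div2r.
Qed.
End Transfer.

Local Open Scope ring_scope.

(** * Expectations and variances *)

Section Expectation.
Variables (R : realFieldType) (d : nat).
Implicit Types (P : nat -> R) (Ps : seq (nat -> R)) (F G f : seq nat -> R).

(** Mean of [F] over words of independent letters with laws [Ps]; the recursion conditions on the
    first letter. *)
Fixpoint Ew Ps F : R :=
  if Ps is P :: Ps' then \sum_(x < d) P x * Ew Ps' (fun w => F (val x :: w))
  else F [::].

Definition prob P := (forall x, 0 <= P x) /\ \sum_(x < d) P x = 1.

Fixpoint probs Ps := if Ps is P :: Ps' then prob P /\ probs Ps' else True.

Definition wf Ps (w : seq nat) := size w = size Ps /\ all (fun x => (x < d)%N) w.

Lemma eq_Ew Ps F G : (forall w, wf Ps w -> F w = G w) -> Ew Ps F = Ew Ps G.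
Proof.
elim: Ps F G => [|P Ps IH] F G H /=; first exact: H.
apply: eq_bigr => x _; congr (_ * _); apply: IH => w [sw aw]; apply: H.
by split; rewrite /= ?sw ?ltn_ord.
Qed.

Lemma ler_Ew Ps F G : probs Ps -> (forall w, wf Ps w -> F w <= G w) -> Ew Ps F <= Ew Ps G.
Proof.
elim: Ps F G => [|P Ps IH] F G /= pr H; first exact: H.
apply: ler_sum => x _; apply: ler_wpM2l; first by apply: (pr.1).1.
apply: IH; first exact: pr.2.
by move=> w [sw aw]; apply: H; split; rewrite /= ?sw ?ltn_ord.
Qed.

Lemma EwD Ps F G : Ew Ps (fun w => F w + G w) = Ew Ps F + Ew Ps G.
Proof.
elim: Ps F G => [|P Ps IH] F G //=.
by rewrite -big_split /=; apply: eq_bigr => x _; rewrite IH mulrDr.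
Qed.

Lemma EwZ Ps c F : Ew Ps (fun w => c * F w) = c * Ew Ps F.
Proof.
elim: Ps F => [|P Ps IH] F //=.
by rewrite mulr_sumr; apply: eq_bigr => x _; rewrite IH mulrCA.
Qed.

Lemma Ew_cst Ps c : probs Ps -> Ew Ps (fun=> c) = c.
Proof.
elim: Ps => [|P Ps IH] //= [[_ p1] /IH H].
by rewrite H -mulr_suml p1 mul1r.
Qed.

Lemma EwB Ps F G : Ew Ps (fun w => F w - G w) = Ew Ps F - Ew Ps G.
Proof.
rewrite EwD; congr (_ + _).
by rewrite -mulN1r -EwZ; apply: eq_Ew => w _; rewrite mulN1r.
Qed.

Lemma Ew_sum (I : Type) (s : seq I) Ps (F : I -> seq nat -> R) :
  Ew Ps (fun w => \sum_(i <- s) F i w) = \sum_(i <- s) Ew Ps (F i).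
Proof.
elim: s => [|i s IH].
  rewrite big_nil -[RHS](mul0r (Ew Ps (fun=> 0))) -EwZ.
  by apply: eq_Ew => w _; rewrite big_nil mul0r.
by rewrite big_cons -IH -EwD; apply: eq_Ew => w _; rewrite big_cons.
Qed.

Lemma Ew_cat Ps Qs F : Ew (Ps ++ Qs) F = Ew Ps (fun v => Ew Qs (fun w => F (v ++ w))).
Proof.
elim: Ps F => [|P Ps IH] F //=.
by apply: eq_bigr => x _; rewrite IH.
Qed.

Lemma probs_cat Ps Qs : probs Ps -> probs Qs -> probs (Ps ++ Qs).
Proof. by elim: Ps => //= P Ps IH [? /IH H] /H. Qed.

Lemma probs_nseq n P : prob P -> probs (nseq n P).
Proof. by move=> pP; elim: n. Qed.

Definition bounded_effect f := forall w1 x w2,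
  f (w1 ++ 0%N :: w2) <= f (w1 ++ x :: w2) <= f (w1 ++ 0%N :: w2) + 1.

(** Sum over positions of the drop of [f] when that single letter is blanked. *)
Fixpoint infl f (w : seq nat) : R :=
  if w is x :: w' then (f (x :: w') - f (0%N :: w')) + infl (fun v => f (x :: v)) w'
  else 0.

Lemma Ew_sqr_shift Ps f c : probs Ps ->
  Ew Ps (fun w => (f w - c) ^+ 2) =
  Ew Ps (fun w => (f w - Ew Ps f) ^+ 2) + (Ew Ps f - c) ^+ 2.
Proof.
move=> pr; set m := Ew Ps f.
rewrite (eq_Ew (G := fun w => (f w - m) ^+ 2 + (2 * (m - c) * (f w - m) + (m - c) ^+ 2))); last first.
  by move=> w _; ring.
rewrite !EwD EwZ Ew_cst // EwB Ew_cst // -/m; ring.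
Qed.

(* Tensorization of the variance; the effect of a letter lies in [0, 1], hence dominates its square. *)
Lemma variance_le_infl Ps f : (0 < d)%N -> probs Ps -> bounded_effect f ->
  Ew Ps (fun w => (f w - Ew Ps f) ^+ 2) <= Ew Ps (infl f).
Proof.
move=> d0; elim: Ps f => [|P Ps IH] f; first by rewrite /= subrr expr0n.
move=> pr bf; have [[P0 P1] prs] := pr.
set m := Ew (P :: Ps) f.
pose mm (x : nat) := Ew Ps (fun w => f (x :: w)).
have mE : m = \sum_(x < d) P x * mm x by [].
(* Recentring at the mean for a blank first letter only increases the second moment, which then
   splits into conditional variances and squared effects of the first letter. *)
have e1 : Ew (P :: Ps) (fun w => (f w - m) ^+ 2) <= \sum_(x < d) P x * Ew Ps (fun w => (f (val x :: w) - mm 0%N) ^+ 2).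
  have := Ew_sqr_shift f (mm 0%N) pr; rewrite -/m [in X in X -> _]/= => ->.
  by rewrite lerDl sqr_ge0.
apply: le_trans e1 _; rewrite [X in _ <= X]/=; apply: ler_sum => x _; apply: ler_wpM2l => //.
rewrite Ew_sqr_shift // EwD addrC; apply: lerD; last first.
  by apply: IH => // w1 y w2; have := bf (val x :: w1) y w2.
rewrite EwB -/(mm x) -/(mm 0%N).
have h0 : mm 0%N <= mm x.
  by apply: ler_Ew => // w _; have /andP[] := bf [::] (val x) w.
have h1 : mm x <= mm 0%N + 1.
  rewrite -[1](Ew_cst 1 prs) -EwD.
  by apply: ler_Ew => // w _; have /andP[] := bf [::] (val x) w.
nra.
Qed.

(** Meant for [f] a maximum and [g] the branch attaining it at [w]: blanking lowers the maximum no
    more than the branch. *)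
Lemma infl_le f g w : (forall v, g v <= f v) -> f w = g w -> infl f w <= infl g w.
Proof.
elim: w f g => [|x w IH] f g gf e //=.
apply: lerD; first by rewrite e lerD2l lerN2.
by apply: IH.
Qed.

Lemma infl_shift f g c w : (forall v, f v = c + g v) -> infl f w = infl g w.
Proof.
elim: w f g => [|x w IH] f g e //=.
rewrite !e; congr (_ + _); last by apply: IH.
by rewrite opprD addrACA subrr add0r.
Qed.

(** Only the letters of one fixed optimal chain can have an effect, and each effect is at most
    one. *)
Lemma infl_ell a w : infl (fun v => (ell a v)%:R) w <= (ell a w)%:R.
Proof.
elim: w a => [|x w IH] a //=; case: ltnP => ax; last first.
  by rewrite subrr add0r; apply: IH.
case: (leqP (ell x w).+1 (ell a w)) => h.
  rewrite subrr add0r; apply: le_trans (IH a).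
  apply: infl_le => [v|]; first by rewrite ler_nat leq_maxl.
  by rewrite (maxn_idPl h).
have h' : (ell x w).+1 = maxn (ell a w) (ell x w).+1 by lia.
have i1 : infl (fun v => (maxn (ell a v) (ell x v).+1)%:R) w <= (ell x w)%:R.
  apply: le_trans (IH x); rewrite -(@infl_shift (fun v => (ell x v).+1%:R) (fun v => (ell x v)%:R) 1); last by move=> v; rewrite -add1n natrD.
  by apply: infl_le => [v|]; [rewrite ler_nat leq_maxr|rewrite -h'].
have : ((ell x w)%:R <= (ell a w)%:R :> R) by rewrite ler_nat; apply: ell_anti; apply: ltnW.
by rewrite -natr1; lra.
Qed.

Lemma infl_slen a w : (0 < a)%N -> infl (fun v => (slen a v)%:R) w <= (slen a w)%:R.
Proof.
move=> a0; elim: w => [|x w IH] //=; case: eqP => _.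
  rewrite -natr1 (@infl_shift _ (fun v => (slen a v)%:R) 1); last by move=> v; rewrite -add1n natrD.
  lra.
case: ltnP => ax; last by rewrite subrr add0r; apply: IH.
case: (leqP (ell x w).+1 (slen a w)) => h.
  rewrite subrr add0r; apply: le_trans IH.
  apply: infl_le => [v|]; first by rewrite ler_nat leq_maxl.
  by rewrite (maxn_idPl h).
have h' : (ell x w).+1 = maxn (slen a w) (ell x w).+1 by lia.
have i1 : infl (fun v => (maxn (slen a v) (ell x v).+1)%:R) w <= (ell x w)%:R.
  apply: le_trans (infl_ell x w); rewrite -(@infl_shift (fun v => (ell x v).+1%:R) (fun v => (ell x v)%:R) 1); last by move=> v; rewrite -add1n natrD.
  by apply: infl_le => [v|]; [rewrite ler_nat leq_maxr|rewrite -h'].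
have : ((ell x w)%:R <= (slen a w)%:R :> R).
  rewrite ler_nat; apply: leq_trans (ell_le_slen w a0); apply: ell_anti; exact: ltnW.
by rewrite -natr1; lra.
Qed.

Lemma infl_count b w : (0 < b)%N -> infl (fun v => (count_mem b v)%:R) w = (count_mem b w)%:R.
Proof.
move=> b0; elim: w => //= x w IH.
rewrite (@infl_shift _ (fun v => (count_mem b v)%:R) (x == b)%:R) => [|v]; last by rewrite natrD.
have -> : (0%N == b) = false by lia.
by rewrite IH !natrD mulr0n add0r addrK.
Qed.

Lemma bounded_effect_nat (f : seq nat -> nat) :
  (forall w1 x w2, (f (w1 ++ 0%N :: w2) <= f (w1 ++ x :: w2) <= (f (w1 ++ 0%N :: w2)).+1)%N) ->
  bounded_effect (fun w => (f w)%:R).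
Proof. by move=> H w1 x w2; rewrite natr1 !ler_nat. Qed.

Lemma variance_ell Ps a : (0 < d)%N -> probs Ps ->
  Ew Ps (fun w => ((ell a w)%:R - Ew Ps (fun w => (ell a w)%:R)) ^+ 2) <= Ew Ps (fun w => (ell a w)%:R).
Proof.
move=> d0 pr; apply: le_trans (variance_le_infl d0 pr _) _.
  by apply: bounded_effect_nat => *; apply: ell_del.
by apply: ler_Ew => // w _; apply: infl_ell.
Qed.

Lemma variance_slen Ps a : (0 < d)%N -> (0 < a)%N -> probs Ps ->
  Ew Ps (fun w => ((slen a w)%:R - Ew Ps (fun w => (slen a w)%:R)) ^+ 2) <= Ew Ps (fun w => (slen a w)%:R).
Proof.
move=> d0 a0 pr; apply: le_trans (variance_le_infl d0 pr _) _.
  by apply: bounded_effect_nat => *; apply: slen_del.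
by apply: ler_Ew => // w _; apply: infl_slen.
Qed.

Lemma variance_count Ps b : (0 < d)%N -> (0 < b)%N -> probs Ps ->
  Ew Ps (fun w => ((count_mem b w)%:R - Ew Ps (fun w => (count_mem b w)%:R)) ^+ 2)
    <= Ew Ps (fun w => (count_mem b w)%:R).
Proof.
move=> d0 b0 pr; apply: le_trans (variance_le_infl d0 pr _) _.
  apply: bounded_effect_nat => w1 x w2; rewrite !count_cat /=.
  have -> : (0%N == b) = false by lia.
  lia.
by apply: ler_Ew => // w _; rewrite infl_count.
Qed.

(* [|z| <= (lam + z ^ 2 / lam) / 2] replaces the square root of the variance. *)
Lemma Ew_maxr_le Ps F G v lam : probs Ps -> 0 < lam ->
  Ew Ps (fun w => (F w - Ew Ps F) ^+ 2) <= v ->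
  Ew Ps (fun w => (G w - Ew Ps G) ^+ 2) <= v ->
  Ew Ps (fun w => Num.max (F w) (G w)) <= Num.max (Ew Ps F) (Ew Ps G) + lam + v / lam.
Proof.
move=> pr l0 vF vG; set mF := Ew Ps F; set mG := Ew Ps G.
apply: (@le_trans _ _ (Ew Ps (fun w => (Num.max mF mG + lam) + ((2 * lam)^-1 * (F w - mF) ^+ 2 + (2 * lam)^-1 * (G w - mG) ^+ 2)))).
  apply: ler_Ew => // w _.
  have q z : z <= lam / 2 + (2 * lam)^-1 * z ^+ 2.
    rewrite -subr_ge0.
    have -> : lam / 2 + (2 * lam)^-1 * z ^+ 2 - z = (2 * lam)^-1 * (z - lam) ^+ 2.
      by field; rewrite gt_eqF.
    by rewrite mulr_ge0 ?sqr_ge0 // invr_ge0; lra.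
  have qF := q (F w - mF); have qG := q (G w - mG).
  have s0 z : 0 <= (2 * lam)^-1 * z ^+ 2 by rewrite mulr_ge0 ?sqr_ge0 // invr_ge0; lra.
  have sF := s0 (F w - mF); have sG := s0 (G w - mG).
  have mx1 : mF <= Num.max mF mG by rewrite le_max lexx.
  have mx2 : mG <= Num.max mF mG by rewrite le_max lexx orbT.
  rewrite ge_max; apply/andP; split; lra.
rewrite !EwD !EwZ !Ew_cst // lerD2l -mulrDr.
have -> : v / lam = (2 * lam)^-1 * (v + v) by field; rewrite gt_eqF.
by rewrite ler_wpM2l ?lerD // invr_ge0; lra.
Qed.

End Expectation.

Section Laws.
Variables (R : realFieldType) (d : nat).
Implicit Types (P : nat -> R) (Ps : seq (nat -> R)) (F G f : seq nat -> R).

Lemma Ew_ffun T P F :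
  Ew d (nseq T P) F = \sum_(x : {ffun 'I_T -> 'I_d}) (\prod_i P (x i)) * F (fword x).
Proof.
elim: T F => [|T IH] F /=.
  rewrite (big_pred1 (ffun0 (card_ord 0))) => [|y]; last first.
    by apply/esym/eqP/ffunP; case.
  by rewrite big_ord0 mul1r /fword /wordl (size0nil (size_enum_ord 0)).
pose h (ax : 'I_d * {ffun 'I_T -> 'I_d}) : {ffun 'I_T.+1 -> 'I_d} :=
  [ffun i => oapp ax.2 ax.1 (unlift ord0 i)].
pose g (x : {ffun 'I_T.+1 -> 'I_d}) := (x ord0, [ffun i => x (lift ord0 i)]).
have hb : bijective h.
  exists g => [[a x]|x].
    rewrite /g /h ffunE unlift_none /=; congr pair.
    by apply/ffunP => i; rewrite !ffunE liftK.
  by apply/ffunP => i; rewrite ffunE; case: unliftP => [j|] -> //=; rewrite ffunE.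
rewrite (reindex h (onW_bij _ hb)) /=.
rewrite -(pair_big predT predT (fun a x => (\prod_i P (h (a, x) i)) * F (fword (h (a, x))))) /=.
apply: eq_bigr => a _; rewrite IH mulr_sumr; apply: eq_bigr => x _.
rewrite mulrA; congr (_ * F _).
  rewrite big_ord_recl ffunE unlift_none /=; congr (_ * _).
  by apply: eq_bigr => i _; rewrite ffunE liftK.
rewrite /fword /wordl enum_ordSl /= ffunE unlift_none /=; congr cons.
by rewrite -map_comp; apply: eq_map => i /=; rewrite ffunE liftK.
Qed.

(** An i.i.d. law is invariant under permuting positions; this puts its mean in the form handled by
    [transfer_bound]. *)
Lemma Ew_perm_avg T P F :
  (T`!)%:R * Ew d (nseq T P) F =
  \sum_(x : {ffun 'I_T -> 'I_d}) (\prod_i P (x i)) *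
     \sum_(p : 'S_T) F (wordl (fun i => x (p i))).
Proof.
have inv (p : 'S_T) : \sum_(x : {ffun 'I_T -> 'I_d}) (\prod_i P (x i)) * F (wordl (fun i => x (p i)))
    = Ew d (nseq T P) F.
  rewrite Ew_ffun [RHS](reindex_inj (@relabel_inj T _ p)) /=.
  apply: eq_bigr => x _; rewrite fword_relabel; congr (_ * _).
  by rewrite (reindex_inj (@perm_inj _ p)) /=; apply: eq_bigr => i _; rewrite ffunE.
under eq_bigr => x _ do rewrite mulr_sumr.
rewrite exchange_big /= (eq_bigr _ (fun p _ => inv p)) sumr_const card_Sn.
by rewrite mulr_natl.
Qed.

Lemma Ew_count T P b : \sum_(x < d) P x = 1 -> (b < d)%N ->
  Ew d (nseq T P) (fun w => (count_mem b w)%:R) = T%:R * P b.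
Proof.
move=> P1 bd; have sT n : Ew d (nseq n P) (fun=> 1) = 1.
  by elim: n => //= n ->; rewrite -mulr_suml P1 mulr1.
elim: T => [|T IH] /=; first by rewrite mul0r.
transitivity (\sum_(x < d) P x * (val x == b)%:R + \sum_(x < d) P x * (T%:R * P b)).
  rewrite -big_split /=; apply: eq_bigr => x _; rewrite -mulrDr -IH; congr (_ * _).
  rewrite (eq_Ew (G := fun w => (val x == b)%:R * 1 + (count_mem b w)%:R)) => [|w _].
    by rewrite EwD EwZ sT mulr1.
  by rewrite natrD mulr1.
rewrite -mulr_suml P1 mul1r (bigD1 (Ordinal bd)) //= eqxx mulr1 big1 => [|x].
  by rewrite -natr1; ring.
by rewrite -val_eqE /= => /negbTE ->; rewrite mulr0.
Qed.

(* The letters 1 and [a] form an i.i.d. sequence inside the word, so shifting it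
   by an independent letter preserves the law. *)
Lemma Ew_step T P p a F : (1 < a)%N -> (a < d)%N -> P 1%N * p = P a * (1 - p) ->
  (1 - p) * Ew d (nseq T P) (fun w => F (step a false w)) +
  p * Ew d (nseq T P) (fun w => F (step a true w)) = Ew d (nseq T P) F.
Proof.
move=> a1 ad pE; elim: T F => [|T IH] F; first by rewrite /=; ring.
have d1 : (1 < d)%N by lia.
have ES G : Ew d (nseq T.+1 P) G = P 1%N * Ew d (nseq T P) (fun w => G (1%N :: w))
    + P a * Ew d (nseq T P) (fun w => G (a :: w))
    + \sum_(x < d | (val x != 1%N) && (val x != a)) P x * Ew d (nseq T P) (fun w => G (val x :: w)).
  rewrite /= (bigD1 (Ordinal d1)) //= (bigD1 (Ordinal ad)) /= -?val_eqE /=; last by lia.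
  by rewrite addrA; congr (_ + _).
rewrite !ES /= !eqxx /= orbT.
have a1F : (1%N == a) = false by lia.
rewrite ?a1F.
have H1 := IH (fun w => F (1%N :: w)); have Ha := IH (fun w => F (a :: w)).
have Hr : (1 - p) * (\sum_(x < d | (val x != 1%N) && (val x != a))
      P x * Ew d (nseq T P) (fun w => F (step a false (val x :: w)))) +
    p * (\sum_(x < d | (val x != 1%N) && (val x != a))
      P x * Ew d (nseq T P) (fun w => F (step a true (val x :: w)))) =
    \sum_(x < d | (val x != 1%N) && (val x != a)) P x * Ew d (nseq T P) (fun w => F (val x :: w)).
  rewrite !mulr_sumr -big_split /=; apply: eq_bigr => x /andP[/negbTE x1 /negbTE xa].
  by rewrite x1 xa /= -(IH (fun w => F (val x :: w))); ring.
rewrite -Hr /= -H1 -Ha.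
set A := Ew _ _ _; set B := Ew _ _ _; set C := Ew _ _ _; set D := Ew _ _ _.
(* The two sides differ only where the stored and the read letter disagree; the balance equation
   gives both orders the same weight. *)
have := congr1 ( *%R^~ (B - C)) pE; lra.
Qed.

End Laws.

(** * Stationary laws and convexity *)

Section Laws.
Variables (R : realFieldType) (N : nat).
Implicit Types (P : nat -> R) (F G f : seq nat -> R).
Notation d := N.+2.
Notation E := (@Ew R d).

Definition letter_law (mu nu : R) (x : nat) : R :=
  if x == 0%N then 1 - N%:R * mu - nu else if x == 1%N then nu else mu.

Definition sink_law (p : R) (b x : nat) : R :=
  if x == 0%N then 1 - p else if x == b then p else 0.

Fixpoint sink_laws (p : R) (a i : nat) : seq (nat -> R) :=
  if i is i'.+1 then sink_law p a.+1 :: sink_laws p a.+1 i' else [::].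

Lemma sum_letter_law mu nu (g : nat -> R) :
  \sum_(x < d) letter_law mu nu x * g x =
  (1 - N%:R * mu - nu) * g 0%N + nu * g 1%N + mu * \sum_(i < N) g i.+2.
Proof.
rewrite !big_ord_recl /= mulr_sumr addrA; congr (_ + _).
Qed.

Lemma letter_law_row mu nu b : (1 < b)%N -> letter_law mu nu b = mu.
Proof. by case: b => [|[|b]]. Qed.

Lemma prob_letter_law mu nu : 0 <= mu -> 0 <= nu -> N%:R * mu + nu <= 1 ->
  prob d (letter_law mu nu).
Proof.
move=> m0 n0 s; split=> [x|].
  by rewrite /letter_law; case: ifP => _; [lra|case: ifP].
rewrite (eq_bigr (fun x : 'I_d => letter_law mu nu x * 1)) => [|x _]; last by rewrite mulr1.
rewrite (sum_letter_law mu nu (fun=> 1)) sumr_const card_ord -mulr_natl; ring.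
Qed.

Lemma sum_sink_law p b (g : nat -> R) : (0 < b)%N -> (b < d)%N ->
  \sum_(x < d) sink_law p b x * g x = (1 - p) * g 0%N + p * g b.
Proof.
move=> b0 bd; rewrite (bigD1 ord0) //= (bigD1 (Ordinal bd)) /=; last by rewrite -val_eqE /=; lia.
rewrite big1 => [|x /andP[x0 xb]].
  have bF : (b == 0%N) = false by lia.
  by rewrite /sink_law /= eqxx bF addr0.
rewrite /sink_law; rewrite -!val_eqE /= in x0 xb.
by rewrite (negbTE x0) (negbTE xb) mul0r.
Qed.

Lemma prob_sink_law p b : (0 < b)%N -> (b < d)%N -> 0 <= p <= 1 -> prob d (sink_law p b).
Proof.
move=> b0 bd /andP[p0 p1]; split=> [x|].
  by rewrite /sink_law; case: ifP => _; [lra|case: ifP].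
rewrite (eq_bigr (fun x : 'I_d => sink_law p b x * 1)) => [|x _]; last by rewrite mulr1.
rewrite (sum_sink_law p (fun=> 1)) //; ring.
Qed.

Lemma probs_sink_laws p a i : (a + i < d)%N -> 0 <= p <= 1 -> probs d (sink_laws p a i).
Proof.
move=> ai p01; elim: i a ai => //= i IH a ai; split; last by apply: IH; lia.
apply: prob_sink_law => //; lia.
Qed.

Lemma size_sink_laws p a i : size (sink_laws p a i) = i.
Proof. by elim: i a => //= i IH a; rewrite IH. Qed.

Lemma eq_Ew_sink p a i F G : (a + i < d)%N ->
  (forall J, all (fun y => (y == 0%N) || (a < y)%N) J -> F J = G J) ->
  E (sink_laws p a i) F = E (sink_laws p a i) G.
Proof.
elim: i a F G => [|i IH] a F G ai H /=; first exact: H.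
rewrite (sum_sink_law p (fun x => E (sink_laws p a.+1 i) (fun w => F (x :: w)))) //; last lia.
rewrite (sum_sink_law p (fun x => E (sink_laws p a.+1 i) (fun w => G (x :: w)))) //; last lia.
have HJ y : (y == 0%N) || (a < y)%N -> E (sink_laws p a.+1 i) (fun w => F (y :: w)) = E (sink_laws p a.+1 i) (fun w => G (y :: w)).
  move=> hy; apply: IH; first by lia.
  move=> J /allP aJ; apply: H; rewrite /= hy; apply/allP => z /aJ; lia.
by rewrite !HJ ?ltnSn ?orbT.
Qed.

(** By [height_step] each row contributes its sink bit, of mean [p], and by [Ew_step] it preserves
    the letter law. After the last row only the sources count, with mean [T * nu]. *)
Lemma Ew_height T mu nu p a i : (0 < a)%N -> (a + i = N.+1)%N ->
  nu * p = mu * (1 - p) ->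
  E (sink_laws p a i) (fun J => E (nseq T (letter_law mu nu)) (fun w => (height a w J)%:R))
    = i%:R * p + T%:R * nu.
Proof.
move=> a0 ai pE; have ad : (a < d)%N by lia.
have s1 : \sum_(x < d) letter_law mu nu x = 1.
  rewrite (eq_bigr (fun x : 'I_d => letter_law mu nu x * 1)) => [|x _]; last by rewrite mulr1.
  rewrite (sum_letter_law mu nu (fun=> 1)) sumr_const card_ord -mulr_natl; ring.
have c1 n : E (nseq n (letter_law mu nu)) (fun=> 1) = 1.
  by elim: n => //= n ->; rewrite -mulr_suml s1 mulr1.
elim: i a a0 ai ad => [|i IH] a a0 ai ad.
  rewrite /= mul0r add0r -(@Ew_count _ d T (letter_law mu nu) 1) //.
  apply: eq_Ew => w [_ /allP aw]; congr (_%:R); rewrite /height /=.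
  have aw' : all (fun x => (x <= a)%N) w by apply/allP => x /aw; lia.
  by rewrite ell_bd0 // slen_bd_count // maxn0.
set Q := nseq T _ in IH c1 *.
rewrite [sink_laws p a i.+1]/=.
rewrite [LHS](sum_sink_law p (fun x => E (sink_laws p a.+1 i) (fun w => E Q (fun w0 => (height a w0 (x :: w))%:R)))) //; last lia.
rewrite -!EwZ -EwD.
transitivity (E (sink_laws p a.+1 i) (fun J => p + E Q (fun w => (height a.+1 w J)%:R))).
  apply: eq_Ew_sink; first lia.
  move=> J aJ.
  rewrite -(@Ew_step _ d T (letter_law mu nu) p a.+1 (fun w => (height a.+1 w J)%:R)) //; last first.
  - by rewrite (@letter_law_row _ _ a.+1).
  - by lia.
  rewrite addrCA; congr (_ + _).
    congr (_ * _); apply: eq_Ew => w _.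
    by have := @height_step a w J false a0 aJ => /= ->.
  rewrite (eq_Ew (G := fun w => 1 + (height a.+1 (step a.+1 true w) J)%:R)) => [|w _].
    by rewrite EwD c1 mulrDr mulr1.
  by have := @height_step a w J true a0 aJ => /= ->; rewrite natrD.
have cs : E (sink_laws p a.+1 i) (fun=> p) = p.
  have : forall b, (b + i < d)%N -> E (sink_laws p b i) (fun=> p) = p; last by apply; lia.
  elim: i {IH ai} => //= i IHi b bi.
  rewrite (sum_sink_law p (fun x => E (sink_laws p b.+1 i) (fun w => p))) //; last lia.
  rewrite IHi; [ring|lia].
rewrite EwD cs IH //; [|lia|lia].
by rewrite -natr1; ring.
Qed.

Lemma Ew_sink_mono p q a i F : (a + i < d)%N -> 0 <= p -> p <= q -> q <= 1 ->
  (forall w1 x w2, F (w1 ++ 0%N :: w2) <= F (w1 ++ x :: w2)) ->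
  E (sink_laws p a i) F <= E (sink_laws q a i) F.
Proof.
move=> + p0 pq q1; elim: i a F => [|i IH] a F ai mF //=.
rewrite (sum_sink_law p (fun x => E (sink_laws p a.+1 i) (fun w => F (x :: w)))) //; last lia.
rewrite (sum_sink_law q (fun x => E (sink_laws q a.+1 i) (fun w => F (x :: w)))) //; last lia.
have H x : E (sink_laws p a.+1 i) (fun w => F (x :: w)) <= E (sink_laws q a.+1 i) (fun w => F (x :: w)).
  by apply: IH => [|w1 y w2]; [lia|apply: (mF (x :: w1))].
have H0 := H 0%N; have Ha := H a.+1.
have : E (sink_laws q a.+1 i) (fun w => F (0%N :: w)) <= E (sink_laws q a.+1 i) (fun w => F (a.+1 :: w)).
  apply: ler_Ew => [|w _]; last by apply: (mF [::]).
  by apply: probs_sink_laws; [lia|apply/andP; split; lra].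
nra.
Qed.

Definition src_mono G := forall w1 w2, G (w1 ++ 0%N :: w2) <= G (w1 ++ 1%N :: w2).

Definition src_supermodular F := forall w1 w2 w3,
  F (w1 ++ 1%N :: w2 ++ 0%N :: w3) + F (w1 ++ 0%N :: w2 ++ 1%N :: w3) <=
  F (w1 ++ 0%N :: w2 ++ 0%N :: w3) + F (w1 ++ 1%N :: w2 ++ 1%N :: w3).

Lemma Ew_letterS T mu nu F :
  E (nseq T.+1 (letter_law mu nu)) F =
  (1 - N%:R * mu - nu) * E (nseq T (letter_law mu nu)) (fun w => F (0%N :: w)) +
  nu * E (nseq T (letter_law mu nu)) (fun w => F (1%N :: w)) +
  mu * \sum_(i < N) E (nseq T (letter_law mu nu)) (fun w => F (i.+2 :: w)).
Proof.
exact: (sum_letter_law mu nu (fun x => E (nseq T (letter_law mu nu)) (fun w => F (x :: w)))).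
Qed.

Lemma Ew_src_mono T mu nu1 nu2 G : 0 <= mu -> 0 <= nu1 -> nu1 <= nu2 -> N%:R * mu + nu2 <= 1 ->
  src_mono G ->
  E (nseq T (letter_law mu nu1)) G <= E (nseq T (letter_law mu nu2)) G.
Proof.
move=> m0 n0 n12 s; elim: T G => [|T IH] G mG //; rewrite !Ew_letterS.
have H x : E (nseq T (letter_law mu nu1)) (fun w => G (x :: w)) <= E (nseq T (letter_law mu nu2)) (fun w => G (x :: w)).
  by apply: IH => w1 w2; apply: (mG (x :: w1)).
apply: lerD; last by apply: ler_wpM2l => //; apply: ler_sum.
have H0 := H 0%N; have H1 := H 1%N.
have : E (nseq T (letter_law mu nu1)) (fun w => G (0%N :: w)) <= E (nseq T (letter_law mu nu1)) (fun w => G (1%N :: w)).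
  apply: ler_Ew => [|w _]; last by apply: (mG [::]).
  by apply: probs_nseq; apply: prob_letter_law => //; lra.
nra.
Qed.

(* Convexity in the density of sources, stated as a comparison of slopes. *)
Lemma Ew_src_convex T mu nu1 nu2 F : 0 <= mu -> 0 <= nu1 -> nu1 <= nu2 -> N%:R * mu + nu2 <= 1 ->
  src_supermodular F ->
  (E (nseq T (letter_law mu nu1)) F - E (nseq T (letter_law mu 0)) F) * (nu2 - nu1) <=
  nu1 * (E (nseq T (letter_law mu nu2)) F - E (nseq T (letter_law mu nu1)) F).
Proof.
move=> m0 n0 n12 s; elim: T F => [|T IH] F mF; first by rewrite /= !subrr mul0r mulr0.
rewrite !Ew_letterS.
have H x : _ := IH (fun w => F (x :: w)) (fun w1 w2 w3 => mF (x :: w1) w2 w3).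
set e0 := E (nseq T (letter_law mu 0)) in H *.
set e1 := E (nseq T (letter_law mu nu1)) in H *.
set e2 := E (nseq T (letter_law mu nu2)) in H *.
have HS : (\sum_(i < N) e1 (fun w => F (i.+2 :: w)) - \sum_(i < N) e0 (fun w => F (i.+2 :: w))) * (nu2 - nu1)
   <= nu1 * (\sum_(i < N) e2 (fun w => F (i.+2 :: w)) - \sum_(i < N) e1 (fun w => F (i.+2 :: w))).
  by rewrite -!sumrB mulr_suml mulr_sumr; apply: ler_sum => i _; apply: H.
(* By supermodularity the gain from a source in front grows with the density of the others. *)
have HG : e1 (fun w => F (1%N :: w) - F (0%N :: w)) <= e2 (fun w => F (1%N :: w) - F (0%N :: w)).
  apply: Ew_src_mono => // w1 w2; have := mF [::] w1 w2 => /=; lra.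
rewrite /e1 /e2 !EwB -/e1 -/e2 in HG.
have H0 := H 0%N.
move: (e0 (fun w => F (0%N :: w))) (e1 (fun w => F (0%N :: w))) (e2 (fun w => F (0%N :: w))) H0 HG => a0 a1 a2.
move: (e1 (fun w => F (1%N :: w))) (e2 (fun w => F (1%N :: w))) (e0 (fun w => F (1%N :: w))) => b1 b2 b0.
move: (\sum_(i < N) _) HS => S1; move: (\sum_(i < N) _) => S0; move: (\sum_(i < N) _) => S2 HS H0 HG.
have r0 : 0 <= 1 - N%:R * mu by lra.
move: (1 - N%:R * mu) r0 => r r0.
(* Once the induction hypotheses are used, what remains is exactly [nu1 * nu2] times [HG]. *)
have k1 := ler_wpM2l m0 HS; have k2 := ler_wpM2l r0 H0.
have n02 : 0 <= nu1 * nu2 by nra.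
have k3 := ler_wpM2l n02 HG.
lra.
Qed.

Lemma Ew_nosrc T mu F G : (forall w, 1%N \notin w -> F w = G w) ->
  E (nseq T (letter_law mu 0)) F = E (nseq T (letter_law mu 0)) G.
Proof.
elim: T F G => [|T IH] F G H; first exact: H.
rewrite !Ew_letterS !mul0r; congr (_ * _ + _ + _ * _).
  by apply: IH => w w1; apply: H.
by apply: eq_bigr => i _; apply: IH => w w1; apply: H.
Qed.

End Laws.

(** * The two bounds *)

Lemma ELlt_upper (R : realType) (k n m : nat) : (0 < k)%N -> (m <= k * n)%N ->
  (k + m)%:R * ELlt R k n <= (m * (k + m) + n * k)%:R.
Proof.
move=> k0 mT; rewrite ELlt_avg mulrA ler_pdivrMr ?ltr0n ?fact_gt0 // -!natrM ler_nat.
have lt_ (i : 'I_(k * n)) : ((if i < m then 1 else (i %/ k).+2) < n.+2)%N.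
  by case: ifP => // _; rewrite !ltnS; apply: base_lt.
pose x : {ffun 'I_(k * n) -> 'I_n.+2} := [ffun i => Ordinal (lt_ i)].
pose y (i : nat) := (if i < m then 1 else (i %/ k).+2)%N.
have xE : fword x = [seq y i | i <- iota 0 (k * n)].
  by rewrite -(wordl_val (k * n) y); apply: eq_map => i; rewrite ffunE.
have [c1 cr] : count_mem 1%N (fword x) = m /\ forall a, (1 < a)%N -> (count_mem a (fword x) <= k)%N.
  rewrite xE; split=> [|a a1]; rewrite count_map.
    rewrite -(subnKC mT) iotaD count_cat add0n.
    rewrite (@eq_in_count _ _ predT); last first.
      by move=> i; rewrite mem_iota /y /= => ->.
    rewrite count_predT size_iota (@eq_in_count _ _ pred0) ?count_pred0 ?addn0 //.
    by move=> i; rewrite mem_iota /y /= => /andP[mi _]; rewrite ltnNge mi.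
  apply: (@leq_trans (count_mem a.-2 [seq i %/ k | i <- iota 0 (k * n)])%N).
    rewrite count_map; apply: sub_count => i /=; rewrite /y; case: ifP => _ /eqP; first by lia.
    by move=> <-.
  rewrite count_divn //; nia.
have rb := ring_bound c1 cr.
rewrite mulnC [X in (_ <= X)%N]mulnC mulnC; apply: leq_trans rb; rewrite leq_mul2l; apply/orP; right.
apply: leq_sum => p _; apply: leq_trans (Llt_le_slen m p) _.
rewrite (_ : wordl _ = wordl (fun i => x (p i))) //.
by apply: eq_map => i; rewrite ffunE.
Qed.

Section Lower.
Variables (R : realType) (k n j : nat) (mu : R).
Hypotheses (k0 : (0 < k)%N) (j0 : (0 < j)%N) (mu0 : 0 <= mu).
Let T := (k * n)%N.
Let K := (k * j)%N.
Let N := (n %/ j)%N.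
Let c := T%:R * mu.
Hypothesis cK : c < K%:R.
Hypothesis mu1 : N%:R * mu <= 1.

(** The last term bounds the mean number of overfull rows: row counts have mean [c] and variance at
    most [c], so Chebyshev's inequality applies at distance [K - c]. *)
Lemma iid_le_ELlt :
  @Ew R N.+2 (nseq T (letter_law N mu 0)) (fun w => (ell 1 w)%:R)
    <= ELlt R k n + N%:R * (c / (K%:R - c) ^+ 2).
Proof.
set P := letter_law N mu 0.
have pP : prob N.+2 P by apply: prob_letter_law => //; rewrite addr0.
have pPs : probs N.+2 (nseq T P) by apply: probs_nseq.
have T0 : 0 < (T`!)%:R :> R by rewrite ltr0n fact_gt0.
pose bad (w : seq nat) := count (fun b => (K < count_mem b w)%N) (iota 2 N).
have e1 : @Ew R N.+2 (nseq T P) (fun w => (ell 1 w)%:R) <=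
    @Ew R N.+2 (nseq T P) (fun w => (bad w)%:R) + ELlt R k n.
  rewrite -(ler_pM2l T0) mulrDr Ew_perm_avg Ew_ffun.
  have -> : (T`!)%:R * ELlt R k n = (\sum_(p : 'S_T) Llt (relabel (base k n) p))%:R.
    by rewrite ELlt_avg mulrC divfK // gt_eqF.
  set L := (\sum_(p : 'S_T) _)%N.
  have -> : L%:R = \sum_(x : {ffun 'I_T -> 'I_N.+2}) (\prod_i P (x i)) * L%:R.
    by rewrite -[LHS](Ew_cst L%:R pPs) Ew_ffun.
  rewrite mulr_sumr -big_split /=; apply: ler_sum => x _.
  rewrite mulrCA -mulrDr; apply: ler_wpM2l; first by apply: prodr_ge0 => i _; apply: pP.1.
  rewrite -natr_sum -natrM -natrD ler_nat; exact: transfer_bound.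
apply: le_trans e1 _; rewrite addrC lerD2l.
have -> : @Ew R N.+2 (nseq T P) (fun w => (bad w)%:R) =
    \sum_(b <- iota 2 N) @Ew R N.+2 (nseq T P) (fun w => (K < count_mem b w)%N%:R).
  rewrite -Ew_sum; apply: eq_Ew => w _; rewrite /bad -sum1_count big_mkcond /= natr_sum.
  by apply: eq_bigr => b _; case: ifP.
have -> : N%:R * (c / (K%:R - c) ^+ 2) = \sum_(b <- iota 2 N) (c / (K%:R - c) ^+ 2).
  by rewrite big_const_seq count_predT size_iota iter_addr_0 mulr_natl.
rewrite big_seq [X in _ <= X]big_seq; apply: ler_sum => b; rewrite mem_iota add2n => /andP[b2 bN].
have Ec : @Ew R N.+2 (nseq T P) (fun w => (count_mem b w)%:R) = c.
  by rewrite Ew_count //; [rewrite /P letter_law_row|apply: pP.2].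
have Kc : 0 < (K%:R - c) ^+ 2 by rewrite exprn_gt0 // subr_gt0.
apply: (@le_trans _ _ (((K%:R - c) ^+ 2)^-1 * @Ew R N.+2 (nseq T P) (fun w => ((count_mem b w)%:R - c) ^+ 2))).
  rewrite -EwZ; apply: ler_Ew => // w _.
  case: ltnP => h /=; last by rewrite mulr_ge0 ?sqr_ge0 // invr_ge0 ltW.
  rewrite mulrC ler_pdivlMr // mul1r.
  have : (K%:R < (count_mem b w)%:R :> R) by rewrite ltr_nat.
  move: cK; nra.
rewrite mulrC ler_wpM2r ?invr_ge0 ?(ltW Kc) //.
have b0 : (0 < b)%N by lia.
by have := variance_count (ltn0Sn N.+1) b0 pPs; rewrite Ec.
Qed.

End Lower.

(** * Stationary words near the optimal source mass *)

Section Stationary.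
Variables (R : realFieldType) (N T : nat) (mu s th lam : R).
Hypothesis (T0 : (0 < T)%N) (mu0 : 0 < mu) (s0 : 0 < s) (th0 : 0 < th) (lam0 : 0 < lam).
Let c := T%:R * mu.
Hypothesis sE : s * s = N%:R * c.
Hypothesis cs : c <= s.
Let t1 := s * (1 + th).
Let t2 := s * (1 + 2 * th).
Hypothesis small : N%:R * c + (t2 - c) <= T%:R.
Let g (t : R) := t + s * s / t - c.
Let err := lam + g t1 / lam.
Hypothesis gap : err < g t1 - (2 * s - c).
Notation Ell := (fun w => (ell 1 w)%:R : R).
Notation Slen := (fun w => (slen 1 w)%:R : R).
Notation d := N.+2.
Notation E := (@Ew R d).

Let T0' : 0 < T%:R :> R. Proof. by rewrite ltr0n. Qed.
Let c0 : 0 < c. Proof. by rewrite mulr_gt0. Qed.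

Definition src_density (t : R) := (t - c) / T%:R.
Definition sink_density (t : R) := c / t.

Lemma density_balance (t : R) : 0 < t ->
  src_density t * sink_density t = mu * (1 - sink_density t).
Proof.
move=> t0; rewrite /src_density /sink_density /c.
by field; rewrite !gt_eqF.
Qed.

Lemma density_bounds (t : R) : s <= t -> t <= t2 ->
  [/\ 0 <= src_density t, N%:R * mu + src_density t <= 1 & 0 <= sink_density t <= 1].
Proof.
(* [lra] does not see section hypotheses *)
have hs0 := s0; have hcs := cs; have hsm := small; have hth := th0.
move=> st tt2; have t0 : 0 < t by lra.
split.
- by rewrite /src_density divr_ge0 ?ler0n // subr_ge0; lra.
- have -> : N%:R * mu + src_density t = (N%:R * c + (t - c)) / T%:R.
    by rewrite /src_density /c; field; rewrite gt_eqF.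
  by rewrite ler_pdivrMr // mul1r; lra.
apply/andP; rewrite /sink_density; split; first by apply: divr_ge0; apply: ltW.
by rewrite ler_pdivrMr // mul1r; lra.
Qed.

(** The [N] sink letters come first, so [drop N] forgets the sinks. *)
Let laws (t : R) := sink_laws (sink_density t) 1 N ++ nseq T (letter_law N mu (src_density t)).

Lemma probs_letters (t : R) : s <= t -> t <= t2 -> probs d (nseq T (letter_law N mu (src_density t))).
Proof.
move=> st tt2; have [n0 n1 _] := density_bounds st tt2.
by apply: probs_nseq; apply: prob_letter_law => //; apply: ltW.
Qed.

Lemma probs_laws (t : R) : s <= t -> t <= t2 -> probs d (laws t).
Proof.
move=> st tt2; have [_ _ p01] := density_bounds st tt2.
apply: probs_cat; last exact: probs_letters.
by apply: probs_sink_laws.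
Qed.

Lemma stationary_mean (t : R) : s <= t -> t <= t2 ->
  E (laws t) (fun v => Num.max (Slen (drop N v)) (Ell v)) = g t.
Proof.
have hs0 := s0; have hcs := cs; have hsm := small; have hth := th0.
move=> st tt2; have t0 : 0 < t by lra.
rewrite Ew_cat.
transitivity (E (sink_laws (sink_density t) 1 N) (fun J =>
    E (nseq T (letter_law N mu (src_density t))) (fun w => (height 1 w J)%:R))).
  apply: eq_Ew => J [sJ _]; apply: eq_Ew => w _.
  rewrite size_sink_laws in sJ; rewrite -{1}sJ drop_size_cat // /height.
  by case: leqP => h; [rewrite max_r|rewrite max_l] => //; rewrite ler_nat // ltnW.
rewrite Ew_height //; last exact: density_balance.
rewrite /g sE /sink_density /src_density; field.
by rewrite !gt_eqF.
Qed.

Lemma mean_slen_laws (t : R) : s <= t -> t <= t2 ->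
  E (laws t) (fun v => Slen (drop N v)) = E (nseq T (letter_law N mu (src_density t))) Slen.
Proof.
move=> st tt2; have [_ _ p01] := density_bounds st tt2; rewrite Ew_cat.
rewrite -[RHS](@Ew_cst R d (sink_laws (sink_density t) 1 N)); last exact: probs_sink_laws.
apply: eq_Ew => J [sJ _]; apply: eq_Ew => w _.
by rewrite size_sink_laws in sJ; rewrite -{1}sJ drop_size_cat.
Qed.

Lemma mean_slen_le (t : R) : s <= t -> t <= t2 ->
  E (nseq T (letter_law N mu (src_density t))) Slen <= g t.
Proof.
move=> st tt2; rewrite -mean_slen_laws // -stationary_mean //.
apply: ler_Ew => [|w _]; first exact: probs_laws.
by rewrite le_max lexx.
Qed.

(** Raising [t] from [s] makes sinks rarer and turns blanks into sources, which these chains ignore.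
    At [t = s] the length is at most the stationary one, of mean [g s]. *)
Lemma mean_sinks_le (t : R) : s <= t -> t <= t2 -> E (laws t) Ell <= 2 * s - c.
Proof.
have hs0 := s0; have hcs := cs; have hsm := small; have hth := th0.
move=> st tt2; have [n0 n1 /andP[p0 p1]] := density_bounds st tt2.
have st2 : s <= t2 by rewrite /t2 mulrDr mulr1 lerDl !mulr_ge0 // ?ltW // ltr0n.
have [m0 m1 /andP[q0 q1]] := density_bounds (lexx s) st2.
have pq : sink_density t <= sink_density s.
  by rewrite /sink_density; apply: ler_wpM2l; [exact: ltW|rewrite lef_pV2 // posrE; lra].
have <- : g s = 2 * s - c by rewrite /g mulfK ?gt_eqF //; ring.
rewrite -stationary_mean // !Ew_cat.
apply: (@le_trans _ _ (E (sink_laws (sink_density s) 1 N) (fun J =>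
   E (nseq T (letter_law N mu (src_density t))) (fun w => Ell (J ++ w))))).
  apply: Ew_sink_mono => // w1 x w2; apply: ler_Ew; first exact: probs_letters.
  by move=> w _; rewrite ler_nat -!catA; have /andP[] := ell_del 1 w1 x (w2 ++ w).
apply: ler_Ew => [|J _]; first by apply: probs_sink_laws => //; apply/andP.
apply: (@le_trans _ _ (E (nseq T (letter_law N mu (src_density s))) (fun w => Ell (J ++ w)))).
  have hst : src_density s <= src_density t.
    by rewrite /src_density ler_wpM2r ?invr_ge0 ?ler0n // lerD2r.
  (* Sources act as blanks for [ell], so the negated length is monotone too; this gives the
     inequality in the direction required. *)
  have mJ : src_mono (fun w => -1 * Ell (J ++ w)).
    move=> w1 w2; have := @ell_src0 1 (J ++ w1) w2 isT; rewrite -!catA => ->; exact: lexx.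
  have := Ew_src_mono T (ltW mu0) m0 hst n1 mJ; rewrite !EwZ; lra.
apply: ler_Ew => [|w _]; first exact: probs_letters.
by rewrite le_max lexx orbT.
Qed.

(** The maximum of both lengths has mean [g t1], within [err] of the larger of the two means. By
    [gap] the sink length falls short, so the source length must reach it. *)
Lemma mean_slen_ge : g t1 - err <= E (nseq T (letter_law N mu (src_density t1))) Slen.
Proof.
have hs0 := s0; have hcs := cs; have hsm := small; have hth := th0.
have st1 : s <= t1 by rewrite /t1 mulrDr mulr1 lerDl mulr_ge0 // ltW.
have t12 : t1 <= t2 by rewrite /t1 /t2 ler_pM2l // lerD2l; lra.
have pr := probs_laws st1 t12.
have d0 : (0 < d)%N by [].
have EX := mean_slen_le st1 t12; have EY := mean_sinks_le st1 t12.
have gt : 2 * s - c <= g t1.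
  have t10 : 0 < t1 by lra.
  have -> : g t1 = 2 * s - c + (t1 - s) ^+ 2 / t1 by rewrite /g; field; rewrite gt_eqF.
  by rewrite lerDl divr_ge0 ?sqr_ge0 ?ltW.
have VX : E (laws t1) (fun v => (Slen (drop N v) - E (laws t1) (fun v => Slen (drop N v))) ^+ 2) <= g t1.
  rewrite mean_slen_laws //; set M := E _ Slen.
  have [_ _ p01] := density_bounds st1 t12.
  rewrite Ew_cat; apply: (@le_trans _ _ M) => //.
  rewrite -[X in _ <= X](@Ew_cst R d (sink_laws (sink_density t1) 1 N)); last exact: probs_sink_laws.
  apply: ler_Ew => [|J [sJ _]]; first exact: probs_sink_laws.
  rewrite size_sink_laws in sJ.
  apply: le_trans (variance_slen d0 (ltnSn 0) (probs_letters st1 t12)).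
  by rewrite le_eqVlt; apply/orP; left; apply/eqP; apply: eq_Ew => w _; rewrite -{1}sJ drop_size_cat.
have VY : E (laws t1) (fun v => (Ell v - E (laws t1) Ell) ^+ 2) <= g t1.
  by apply: le_trans (variance_ell 1 d0 pr) _; apply: le_trans EY gt.
have := Ew_maxr_le pr lam0 VX VY; rewrite stationary_mean // mean_slen_laws // -addrA -/err.
rewrite -lerBlDr le_max => /orP[//|]; have := gap; lra.
Qed.

(** By convexity the slope from density 0 up to [t1] is at most that from [t1] to [t2], where both
    values are known up to [err]. Without sources [slen] is [ell]. *)
Lemma mean_ell_ge :
  (g t1 - err - E (nseq T (letter_law N mu 0)) Ell) * (th * s) <=
  (t1 - c) * (g t2 - g t1 + err).
Proof.
have hs0 := s0; have hcs := cs; have hsm := small; have hth := th0.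
have st1 : s <= t1 by rewrite /t1 mulrDr mulr1 lerDl mulr_ge0 // ltW.
have t12 : t1 <= t2 by rewrite /t1 /t2 ler_pM2l // lerD2l; lra.
have [n10 n11 _] := density_bounds st1 t12.
have [n20 n21 _] := density_bounds (le_trans st1 t12) (lexx t2).
have n12 : src_density t1 <= src_density t2 by rewrite /src_density ler_wpM2r ?invr_ge0 ?ler0n // lerD2r.
have sm : src_supermodular Slen.
  by move=> w1 w2 w3; rewrite -!natrD ler_nat; apply: slen_supermodular.
have := Ew_src_convex T (ltW mu0) n10 n12 n21 sm.
have -> : E (nseq T (letter_law N mu 0)) Slen = E (nseq T (letter_law N mu 0)) Ell.
  by apply: Ew_nosrc => w nw; rewrite ell_slen_nosrc.
have := mean_slen_ge; have := mean_slen_le (le_trans st1 t12) (lexx t2).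
set M1 := E (nseq T (letter_law N mu (src_density t1))) Slen.
set M2 := E (nseq T (letter_law N mu (src_density t2))) Slen.
set M0 := E _ Ell => u2 l1.
have -> : src_density t2 - src_density t1 = (th * s) / T%:R.
  by rewrite /src_density /t1 /t2; field; rewrite gt_eqF.
rewrite /src_density mulrA [X in _ <= X]mulrAC ler_pM2r ?invr_gt0 // => cv.
have ts : 0 < th * s by rewrite mulr_gt0.
have tc : 0 <= t1 - c by lra.
apply: (@le_trans _ _ ((M1 - M0) * (th * s))).
  by rewrite ler_pM2r //; lra.
apply: le_trans cv _; apply: ler_wpM2l => //; lra.
Qed.

End Stationary.

Lemma mean_ell_lower (R : realFieldType) (N T : nat) (mu s th : R) :
  (0 < T)%N -> 0 < mu -> 0 < s -> 0 < th -> th <= 1 / 4 -> 6 <= s * th ^+ 5 ->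
  s * s = N%:R * (T%:R * mu) -> T%:R * mu <= s ->
  N%:R * (T%:R * mu) + (s * (1 + 2 * th) - T%:R * mu) <= T%:R ->
  2 * s - T%:R * mu - 10 * th * s <=
  @Ew R N.+2 (nseq T (letter_law N mu 0)) (fun w => (ell 1 w)%:R).
Proof.
move=> T0 mu0 s0 th0 th4 sth sE cs small.
set c := T%:R * mu in sE cs small *.
have c0 : 0 < c by rewrite mulr_gt0 // ltr0n.
(* Makes both parts of [err] small against the excess of [g] over its minimum, about [s * th ^+ 2]:
   [lam] by [th <= 1 / 4], and [g / lam] by [6 <= s * th ^+ 5]. *)
pose lam := th ^+ 3 * s.
have lam0 : 0 < lam by rewrite mulr_gt0 // exprn_gt0.
pose g t := t + s * s / t - c.
have gE x : 0 <= x -> g (s * (1 + x)) = 2 * s - c + s * (x ^+ 2 / (1 + x)).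
  by move=> x0; rewrite /g; field; rewrite !gt_eqF //; lra.
have g1 : g (s * (1 + th)) = 2 * s - c + s * (th ^+ 2 / (1 + th)) by rewrite gE // ltW.
have g2 : g (s * (1 + 2 * th)) = 2 * s - c + s * ((2 * th) ^+ 2 / (1 + 2 * th)) by rewrite gE //; lra.
have th2 : 0 < th ^+ 2 by rewrite exprn_gt0.
have q1 : (4 / 5) * th ^+ 2 <= th ^+ 2 / (1 + th).
  by rewrite ler_pdivlMr; nra.
have q1' : th ^+ 2 / (1 + th) <= th ^+ 2 by rewrite ler_pdivrMr; nra.
have q2 : (2 * th) ^+ 2 / (1 + 2 * th) <= 4 * th ^+ 2 by rewrite ler_pdivrMr; nra.
have g13 : g (s * (1 + th)) <= 3 * s.
  rewrite g1.
  have : s * (th ^+ 2 / (1 + th)) <= s * 1 by rewrite ler_pM2l //; nra.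
  lra.
have elam : g (s * (1 + th)) / lam <= s * (th ^+ 2 / 2).
  rewrite ler_pdivrMr //; apply: le_trans g13 _.
  have -> : s * (th ^+ 2 / 2) * lam = s / 2 * (s * th ^+ 5) by rewrite /lam; ring.
  have -> : 3 * s = s / 2 * 6 by field.
  by rewrite ler_pM2l // divr_gt0.
have lamE : lam <= s * (th ^+ 2 / 4).
  rewrite /lam mulrC ler_pM2l // exprS mulrC; apply: ler_wpM2l; lra.
pose err := lam + g (s * (1 + th)) / lam.
have errE : err <= s * (3 / 4 * th ^+ 2) by rewrite /err; lra.
have sq1 : s * ((4 / 5) * th ^+ 2) <= s * (th ^+ 2 / (1 + th)) by rewrite ler_pM2l.
have sq2 : s * ((2 * th) ^+ 2 / (1 + 2 * th)) <= s * (4 * th ^+ 2) by rewrite ler_pM2l.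
have sq3 : 0 <= s * (th ^+ 2 / (1 + th)) by apply: le_trans sq1; rewrite mulr_ge0 // ltW //; nra.
have sth2 : 0 < s * th ^+ 2 by rewrite mulr_gt0.
have gap : err < g (s * (1 + th)) - (2 * s - c) by rewrite g1; lra.
have := mean_ell_ge T0 mu0 s0 th0 lam0 sE cs small gap.
rewrite -/c -/(g _) -/(g _) -/err.
set M0 := Ew _ _ _ => H.
have ths : 0 < th * s by rewrite mulr_gt0.
have H1 : (2 * s - c - M0) * (th * s) <= (g (s * (1 + th)) - err - M0) * (th * s).
  by rewrite ler_pM2r //; lra.
have tc : 0 <= s * (1 + th) - c by nra.
have H2 : (s * (1 + th) - c) * (g (s * (1 + 2 * th)) - g (s * (1 + th)) + err) <= (2 * s) * (s * (5 * th ^+ 2)).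
  apply: ler_pM => //; first last.
  - by rewrite g2 g1; lra.
  - nra.
  have q3 : 1 * th ^+ 2 <= (2 * th) ^+ 2 / (1 + 2 * th) by rewrite ler_pdivlMr; nra.
  have sq4 : s * (th ^+ 2 / (1 + th)) <= s * ((2 * th) ^+ 2 / (1 + 2 * th)) by rewrite ler_pM2l //; lra.
  have e0 : 0 <= g (s * (1 + th)) / lam by rewrite divr_ge0 ?(ltW lam0) // g1; lra.
  by rewrite g2 g1 /err; lra.
have H3 : (2 * s - c - M0) * (th * s) <= (10 * th * s) * (th * s).
  apply: le_trans H1 (le_trans H (le_trans H2 _)).
  by rewrite le_eqVlt; apply/orP; left; apply/eqP; ring.
move: H3; rewrite ler_pM2r //; lra.
Qed.

(** With [r < k + m <= r + 1], the bound [m + r * r / (k + m)] is at most [(r - k + 1) + r]. *)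
Lemma ELlt_le (R : realType) (k n : nat) : (0 < k)%N -> (k <= n)%N ->
  ELlt R k n <= 2 * Num.sqrt ((n * k)%:R) - k%:R + 1.
Proof.
move=> k0 kn; set r := Num.sqrt _.
have r2 : r * r = n%:R * k%:R by rewrite -expr2 sqr_sqrtr ?ler0n // natrM.
have r0 : 0 <= r by apply: sqrtr_ge0.
have k1 : 1 <= k%:R :> R by rewrite ler1n.
have knR : k%:R <= n%:R :> R by rewrite ler_nat.
have kr : k%:R <= r by rewrite -(ler_pXn2r (ltn0Sn 1)) ?nnegrE ?ler0n // !expr2; nra.
have rk0 : 0 <= r - k%:R by lra.
pose m := (Num.truncn (r - k%:R)).+1.
have /andP[m1 m2] : (m%:R - 1 <= r - k%:R < m%:R).
  by have := truncn_itv rk0; rewrite /m -natr1 addrK.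
have mT : (m <= k * n)%N.
  rewrite -(ler_nat R) natrM; nra.
have up := ELlt_upper R k0 mT.
have t0 : 0 < k%:R + m%:R :> R by lra.
rewrite natrD in up.
rewrite -(ler_pM2l t0); apply: le_trans up _.
rewrite natrD !natrM natrD -r2; nra.
Qed.

(** The bounds serve in turn to keep [- c] close to [- k], to make overfull rows rare, to keep
    [N * c] close to [r * r] from both sides, and to ensure [c <= s]. *)
Lemma merge_size (R : realType) (k n : nat) (r del : R) :
  (0 < k)%N -> (k <= n)%N -> 0 < r -> r * r = n%:R * k%:R ->
  0 < del -> del <= 1 / 8 -> 2 <= r ->
  exists2 j, (0 < j)%N & forall K N, K = (k * j)%N -> N = (n %/ j)%N ->
  [/\ K%:R <= k%:R + del * r, del * r <= 2 * K%:R, N%:R * K%:R <= r * r,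
      r * r - r <= N%:R * K%:R & K%:R <= N%:R :> R].
Proof.
move=> k0 kn r0 r2 del0 del1 r2'.
have k1 : 1 <= k%:R :> R by rewrite ler1n.
have knR : k%:R <= n%:R :> R by rewrite ler_nat.
have kr : k%:R <= r.
  by rewrite -(ler_pXn2r (ltn0Sn 1)) ?nnegrE ?ler0n ?(ltW r0) // !expr2 r2 ler_wpM2r ?ler0n.
have dr0 : 0 < del * r by rewrite mulr_gt0.
pose y := del * r / k%:R.
have y0 : 0 <= y by rewrite /y mulr_ge0 ?invr_ge0 ?ler0n // ltW.
pose j := maxn 1 (Num.truncn y).
have /andP[ty1 ty2] := truncn_itv y0.
have j0 : (0 < j)%N by rewrite leq_max.
have ky : k%:R * y = del * r by rewrite /y mulrC divfK // pnatr_eq0 -lt0n.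
have jcases : j = 1%N \/ k%:R * j%:R <= del * r.
  rewrite /j; case: (leqP (Num.truncn y) 1) => h; [by left|right].
  by rewrite -ky ler_pM2l ?ltr0n.
have jy : y <= 2 * j%:R.
  have j1 : 1 <= j%:R :> R by rewrite ler1n.
  have jt : (Num.truncn y)%:R <= j%:R :> R by rewrite ler_nat leq_maxr.
  by move: ty2 j1 jt; rewrite -natr1; lra.
exists j => // K N KD ND.
have KE : K%:R = k%:R * j%:R :> R by rewrite KD natrM.
have K0 : 0 < K%:R :> R by rewrite ltr0n KD muln_gt0 k0.
have Kr : del * r <= 2 * K%:R.
  by rewrite KE -ky [X in _ <= X]mulrCA ler_wpM2l ?ler0n.
have Kle : K%:R <= k%:R + del * r.
  by case: jcases => h; rewrite KE; [rewrite h mulr1 lerDl ltW | apply: le_trans h _; rewrite lerDr ler0n].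
have dr : del * r <= r / 8 by rewrite mulrC ler_pM2l // -[8^-1]mul1r.
have NK1 : N%:R * K%:R <= r * r.
  rewrite r2 -!natrM ler_nat ND KD mulnCA mulnC leq_mul2r leq_divM orbT //.
have Kr1 : K%:R <= r.
  case: jcases => h; first by rewrite KE h mulr1.
  by rewrite KE; apply: le_trans h (le_trans dr _); move: r0; lra.
(* The rows lost to rounding in [n %/ j] hold fewer than [K <= r] items. *)
have NK2 : r * r - r <= N%:R * K%:R.
  have : (n * k)%:R <= (N * K + K)%:R :> R.
    rewrite ler_nat ND KD -mulSnr mulnCA [X in (_ <= X)%N]mulnC leq_mul2r.
    by rewrite ltnW ?orbT // ltn_ceil.
  rewrite natrD !natrM -r2; move: Kr1; move: (N%:R * K%:R) => z; lra.
split=> //.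
case: jcases => h; first by rewrite ler_nat KD ND h muln1 divn1.
(* Here [K <= r / 8], so [N < K] would make [N * K] far smaller than [r * r - r]. *)
rewrite leNgt; apply/negP => NK.
have K8 : K%:R <= r / 8 by rewrite KE; apply: le_trans h dr.
have : N%:R * K%:R <= (r / 8) * (r / 8).
  by apply: ler_pM; rewrite ?ler0n //; apply: le_trans K8; exact: ltW.
have : 2 * r <= r * r by rewrite ler_pM2r.
move: NK2 r0; lra.
Qed.

Lemma ELlt_ge (R : realType) (k n : nat) (e : R) : (0 < k)%N -> (k <= n)%N ->
  0 < e -> e <= 1 -> 12 * 40 ^+ 5 <= Num.sqrt ((n * k)%:R) * e ^+ 5 ->
  2 * Num.sqrt ((n * k)%:R) - k%:R - e * Num.sqrt ((n * k)%:R) <= ELlt R k n.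
Proof.
move=> k0 kn e0 e1; set r := Num.sqrt _ => re.
have r2 : r * r = n%:R * k%:R by rewrite -expr2 sqr_sqrtr ?ler0n // natrM.
have r0 : 0 <= r by apply: sqrtr_ge0.
have k1 : 1 <= k%:R :> R by rewrite ler1n.
have knR : k%:R <= n%:R :> R by rewrite ler_nat.
have kr : k%:R <= r by rewrite -(ler_pXn2r (ltn0Sn 1)) ?nnegrE ?ler0n // !expr2; nra.
have n0 : (0 < n)%N by apply: leq_trans kn.
(* Losses in units of [e * r]: 1/4 from [s >= (1 - del) * r], 1/8 from [K <= k + del * r], 1/4 from
   [10 * th * s], and 1/8 from overfull rows. *)
pose del := e / 8; pose th := e / 40.
have del0 : 0 < del by rewrite divr_gt0.
have th0 : 0 < th by rewrite divr_gt0.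
have e5 : e ^+ 5 <= e.
  by rewrite -[X in _ <= X]expr1; apply: ler_wiXn2l => //; apply: ltW.
have rpos : 0 < r.
  rewrite lt_neqAle r0 andbT; apply/eqP => rz; move: re; rewrite -rz mul0r; lra.
have rbig : 12 * 40 ^+ 5 <= r * e by apply: le_trans re _; rewrite ler_pM2l.
have r1000 : 1000 <= r.
  have : r * e <= r * 1 by rewrite ler_pM2l.
  move: rbig; lra.
have del1 : del <= 1 / 8 by rewrite /del; move: e1; lra.
have [|j j0 /(_ _ _ erefl erefl)[]] := merge_size k0 kn rpos r2 del0 del1; first by move: r1000; lra.
set K := (k * j)%N; set N := (n %/ j)%N => Kle Kr NK1 NK2 KN.
have K0 : 0 < K%:R :> R by rewrite ltr0n muln_gt0 k0.
pose T := (k * n)%N.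
have T0 : (0 < T)%N by rewrite muln_gt0 k0.
have TE : T%:R = r * r :> R by rewrite r2 natrM mulrC.
have TR0 : 0 < T%:R :> R by rewrite ltr0n.
(* Rows get [(1 - del) * K] letters on average, leaving a margin [del * K] for fluctuations. *)
pose mu := (1 - del) * K%:R / T%:R.
have mu0 : 0 < mu by rewrite divr_gt0 // mulr_gt0 //; lra.
have cE : T%:R * mu = (1 - del) * K%:R by rewrite /mu mulrC divfK // gt_eqF.
pose s := Num.sqrt (N%:R * (T%:R * mu)).
have s2 : s * s = N%:R * (T%:R * mu).
  by rewrite -expr2 sqr_sqrtr // cE !mulr_ge0 ?ler0n //; lra.
have s0' : 0 <= s by apply: sqrtr_ge0.
have s2E : s * s = (1 - del) * (N%:R * K%:R) by rewrite s2 cE; ring.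
have rdel : 1 <= del * r by rewrite /del; lra.
have sr1 : (1 - del) * r <= s.
  rewrite -(ler_pXn2r (ltn0Sn 1)) ?nnegrE //; last by apply: mulr_ge0 => //; lra.
  rewrite !expr2 s2E.
  have : (1 - del) * (r * r - r) <= (1 - del) * (N%:R * K%:R) by apply: ler_wpM2l => //; lra.
  have : 0 <= (1 - del) * r * (del * r - 1) by apply: mulr_ge0; [apply: mulr_ge0 => //|]; lra.
  lra.
have sr2 : s <= r.
  by rewrite -(ler_pXn2r (ltn0Sn 1)) ?nnegrE // !expr2 s2E; nra.
have s0 : 0 < s by nra.
have cs : T%:R * mu <= s.
  rewrite -(ler_pXn2r (ltn0Sn 1)) ?nnegrE // ?(mulr_ge0 (ltW TR0) (ltW mu0)) //.
  rewrite !expr2 s2E cE.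
  have : 0 <= (1 - del) * K%:R * (N%:R - K%:R + del * K%:R).
    by apply: mulr_ge0; [apply: mulr_ge0|]; nra.
  lra.
(* The constant [12 * 40 ^+ 5] of the hypothesis comes from here, with [s >= r / 2]. *)
have sth : 6 <= s * th ^+ 5.
  have : (r / 2) * th ^+ 5 <= s * th ^+ 5.
    by rewrite ler_pM2r ?exprn_gt0 //; nra.
  apply: le_trans.
  have -> : r / 2 * th ^+ 5 = (r * e ^+ 5) / (2 * 40 ^+ 5) by rewrite /th; field.
  by rewrite ler_pdivlMr; lra.
(* Row letters leave at least [del * (r * r)] of the positions, and the sources need at most
   [2 * r]. *)
have small : N%:R * (T%:R * mu) + (s * (1 + 2 * th) - T%:R * mu) <= T%:R.
  rewrite -{1}s2 s2E cE TE.
  have : (1 - del) * (N%:R * K%:R) <= (1 - del) * (r * r) by apply: ler_wpM2l => //; lra.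
  have th1 : th <= 1 / 40 by rewrite /th; lra.
  have : s * (1 + 2 * th) <= r * 2 by nra.
  have : r * 2 <= r * (del * r) by apply: ler_wpM2l => //; rewrite /del; lra.
  have : 0 <= (1 - del) * K%:R by apply: mulr_ge0; lra.
  lra.
have th4 : th <= 1 / 4 by rewrite /th; lra.
have low := mean_ell_lower T0 mu0 s0 th0 th4 sth s2 cs small.
have cK : T%:R * mu < K%:R by rewrite cE; nra.
have mu1 : N%:R * mu <= 1.
  rewrite /mu mulrA ler_pdivrMr // TE; nra.
have tr := iid_le_ELlt k0 j0 (ltW mu0) cK mu1.
(* As [del * r <= 2 * K], the left side is at most [4 / del ^+ 4], a constant once [e] is fixed. *)
have bad : N%:R * (T%:R * mu / (K%:R - T%:R * mu) ^+ 2) <= e / 8 * r.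
  rewrite cE.
  have -> : N%:R * ((1 - del) * K%:R / (K%:R - (1 - del) * K%:R) ^+ 2) =
      (1 - del) * (N%:R * K%:R) / (del * K%:R) ^+ 2.
    by field; rewrite !gt_eqF //; lra.
  rewrite ler_pdivrMr; last by rewrite exprn_gt0 // mulr_gt0.
  apply: (@le_trans _ _ (r * r)).
    apply: le_trans NK1; rewrite ler_piMl ?mulr_ge0 ?ler0n //; lra.
  have dK : (del * (del * r)) ^+ 2 <= (2 * (del * K%:R)) ^+ 2.
    have h1 : 0 <= del * (del * r) by apply: mulr_ge0; [|apply: mulr_ge0]; rewrite // ltW.
    have h2 : 0 <= 2 * (del * K%:R) by apply: mulr_ge0; [|apply: mulr_ge0]; rewrite ?ler0n // ltW.
    by rewrite ler_pXn2r ?nnegrE // [X in _ <= X]mulrCA ler_pM2l.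
  apply: (@le_trans _ _ (e / 8 * r * ((del * (del * r)) ^+ 2 / 4))); last first.
    apply: ler_wpM2l; first by apply: mulr_ge0 => //; apply: divr_ge0; rewrite ?ler0n // ltW.
    rewrite ler_pdivrMr //; apply: le_trans dK _.
    by rewrite le_eqVlt; apply/orP; left; apply/eqP; ring.
  have -> : e / 8 * r * ((del * (del * r)) ^+ 2 / 4) = (r * r) * (r * e ^+ 5 / (4 * 8 ^+ 5)).
    by rewrite /del; field.
  rewrite ler_peMr ?mulr_ge0 // ler_pdivlMr; lra.
have thr : 10 * th * s <= e / 4 * r by rewrite /th; nra.
move: low tr bad; rewrite /T /N in thr *; rewrite cE; rewrite /del in sr1 Kle *.
move=> low tr bad.
have : (1 - e / 8) * K%:R <= K%:R by nra.
nra.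
Qed.

(* E[L_<(S_{k_n;n})] = 2 sqrt(n k_n) - k_n + o(sqrt(n k_n)), written out:
   for every eps > 0, eventually |E - (2 sqrt(n k_n) - k_n)| <= eps sqrt(n k_n). *)
Theorem theorem1 (R : realType) (k : nat -> nat)
  (hk : forall n : nat, (0 < n)%N -> (0 < k n)%N /\ (k n <= n)%N) :
  forall eps : R, 0 < eps ->
  exists N : nat, forall n : nat, (N <= n)%N ->
    `| ELlt R (k n) n - (2 * Num.sqrt ((n * k n)%:R) - (k n)%:R) |
      <= eps * Num.sqrt ((n * k n)%:R).
Proof.
move=> eps eps0; pose e := Num.min eps 1.
have e0 : 0 < e by rewrite lt_min eps0 ltr01.
have e1 : e <= 1 by rewrite ge_min lexx orbT.
have eeps : e <= eps by rewrite ge_min lexx.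
have e50 : 0 < e ^+ 5 by rewrite exprn_gt0.
pose B : R := 12 * 40 ^+ 5 / e ^+ 5.
have B0 : 0 <= B by rewrite divr_ge0 ?(ltW e50) // mulr_ge0 ?exprn_ge0.
exists (Num.truncn (B ^+ 2)).+1 => n nN.
have n0 : (0 < n)%N by apply: leq_trans nN.
have [k0 kn] := hk n n0.
have Br : B <= Num.sqrt ((n * k n)%:R).
  rewrite -(ler_pXn2r (ltn0Sn 1)) ?nnegrE ?sqrtr_ge0 // sqr_sqrtr ?ler0n //.
  have /andP[_ /ltW B2] := truncn_itv (sqr_ge0 B); apply: le_trans B2 _.
  by rewrite ler_nat; apply: leq_trans nN _; rewrite leq_pmulr.
have re : 12 * 40 ^+ 5 <= Num.sqrt ((n * k n)%:R) * e ^+ 5 by rewrite -ler_pdivrMr.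
have low := ELlt_ge k0 kn e0 e1 re.
have up := ELlt_le R k0 kn.
set r := Num.sqrt _ in re low up *.
have r0 : 0 <= r by apply: sqrtr_ge0.
(* Absorbs the [+ 1] of the upper bound. *)
have one : 1 <= r * e.
  have e5 : e ^+ 5 <= e by rewrite -[X in _ <= X]expr1 ler_wiXn2l // ltW.
  apply: le_trans (ler_wpM2l r0 e5); apply: le_trans re; lra.
have er : e * r <= eps * r by apply: ler_wpM2r.
rewrite ler_norml; lra.
Qed.
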